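(* Let $k \geq 1$ be an integer, let $m \ge 0$ be an even integer, and let $Z \in \operatorname{Mat}_{k+m,k+m+1}$ be a matrix with all $(k+m)\times (k+m)$ minors positive. Then the amplituhedron $\mathcal{A}_{k+m+1,k,m}(Z)$ induced by the matrix $Z$ is homeomorphic to a $km$-dimensional ball.
   Context: For integers $n \geq k \geq 1$, $\operatorname{Mat}_{k,n}$ is the space of real $k\times n$ matrices of rank $k$, and $\operatorname{G}_k(\mathbb{R}^n)=\operatorname{GL}_k\backslash \operatorname{Mat}_{k,n}$ is the real Grassmannian of $k$-dimensional linear subspaces of $\mathbb{R}^n$ (with the quotient topology). $\operatorname{Mat}_{k,n}^{\ge 0}\subseteq \operatorname{Mat}_{k,n}$ is the subspace of those matrices all of whose $k\times k$ minors are nonnegative. $\operatorname{GL}_k^+$ is the group of real $k\times k$ matrices with positive determinant, acting on $\operatorname{Mat}_{k,n}^{\ge 0}$ by left multiplication. The totally nonnegative Grassmannian is $\operatorname{G}_k^{\ge 0}(\mathbb{R}^n)=\operatorname{GL}_k^+\backslash \operatorname{Mat}_{k,n}^{\ge 0}$; its points are identified with the row spans of the matrices in $\operatorname{Mat}_{k,n}^{\ge 0}$. Here $\operatorname{span}(V)$ denotes the row span of a matrix $V$. Let $k\ge 1$, $m\ge 0$, $n\ge k+m$ be integers and let $Z$ be a real $(k+m)\times n$ matrix all of whose $(k+m)\times(k+m)$ minors are positive. Then (a known fact) $\operatorname{span}(VZ^\top)$ is $k$-dimensional for every $V\in \operatorname{Mat}_{k,n}^{\ge 0}$, so that $\widetilde{Z}(\operatorname{span}(V))=\operatorname{span}(VZ^\top)$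 defines a map $\widetilde{Z}\colon \operatorname{G}_k^{\ge 0}(\mathbb{R}^n)\to \operatorname{G}_k(\mathbb{R}^{k+m})$. The amplituhedron $\mathcal{A}_{n,k,m}(Z)$ is the image $\widetilde{Z}(\operatorname{G}_k^{\ge 0}(\mathbb{R}^n))\subseteq \operatorname{G}_k(\mathbb{R}^{k+m})$ with the subspace topology. ''Ball'' means closed ball. *)

(* Defs.v *)
From HB Require Import structures.
From mathcomp Require Import all_boot all_order all_algebra.
From mathcomp Require Import generic_quotient.
From mathcomp Require Import all_classical all_reals all_analysis.

Set Implicit Arguments.
Unset Strict Implicit.
Unset Printing Implicit Defensive.

Import Order.TTheory GRing.Theory Num.Theory.
Import numFieldNormedType.Exports.

Local Open Scope classical_set_scope.
Local Open Scope ring_scope.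
Local Open Scope quotient_scope.

Definition homeomorphic (X Y : topologicalType) : Prop :=
  exists (f : X -> Y) (g : Y -> X),
    [/\ continuous f, continuous g, cancel f g & cancel g f].

Definition closed_euclidean_ball (R : realType) (d : nat) : set 'rV[R]_d :=
  [set x | \sum_(i < d) x ord0 i ^+ 2 <= 1].
Arguments closed_euclidean_ball : clear implicits.

(* A maximal minor is indexed by an increasing choice of k columns. *)
Definition increasing_cols (k n : nat) (f : 'I_k -> 'I_n) : Prop :=
  forall i j : 'I_k, (i < j)%N -> (f i < f j)%N.

Definition max_minors_pos (R : realType) (k n : nat) (A : 'M[R]_(k, n)) :
    Prop :=
  forall f : 'I_k -> 'I_n, increasing_cols f -> 0 < \det (colsub f A).

Definition max_minors_nonneg (R : realType) (k n : nat) (A : 'M[R]_(k, n)) :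
    Prop :=
  forall f : 'I_k -> 'I_n, increasing_cols f -> 0 <= \det (colsub f A).

Definition full_rank (R : realType) (k n : nat) : set 'M[R]_(k, n) :=
  [set A | \rank A = k].
Arguments full_rank : clear implicits.

(* [set_type] carries the topology induced from that of 'M[R]_(k, n). *)
Definition Mat (R : realType) (k n : nat) : topologicalType :=
  set_type (full_rank R k n).

Section Grassmannian.
Variables (R : realType) (k n : nat).
Implicit Types A B : Mat R k n.

Definition gl_equiv A B : bool :=
  `[< exists2 g : 'M[R]_k, g \in unitmx & set_val A = g *m set_val B >].

Lemma gl_equiv_refl : reflexive gl_equiv.
Proof. by move=> A; apply/asboolP; exists 1%:M; rewrite ?unitmx1 ?mul1mx. Qed.

Lemma gl_equiv_sym : symmetric gl_equiv.
Proof.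
suff H A B : gl_equiv A B -> gl_equiv B A by move=> A B; apply/idP/idP; exact: H.
move=> /asboolP[g gU AB]; apply/asboolP; exists (invmx g).
  by rewrite unitmx_inv.
by rewrite AB mulKmx.
Qed.

Lemma gl_equiv_trans : transitive gl_equiv.
Proof.
move=> B A C /asboolP[g gU AB] /asboolP[h hU BC]; apply/asboolP.
by exists (g *m h); rewrite ?unitmx_mul ?gU// -mulmxA -BC.
Qed.

Canonical gl_equiv_rel :=
  EquivRel gl_equiv gl_equiv_refl gl_equiv_sym gl_equiv_trans.

Definition Gr : topologicalType := quotient_topology {eq_quot gl_equiv_rel}.

(* The row span of A, as a point of GL_k \ Mat_{k,n}; see [rowspan_eqP]. *)
Definition rowspan A : Gr := \pi_{eq_quot gl_equiv_rel} A.

Lemma rowspan_eqP A B : rowspan A = rowspan B <-> (set_val A == set_val B)%MS.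
Proof.
split=> [/eqmodP/asboolP[g gU ->]|/eqmxMunitP[g gU AB]].
  by apply/eqmxMunitP; exists g.
by apply/eqmodP/asboolP; exists g.
Qed.

Definition Mat_tnn : set (Mat R k n) :=
  [set A | max_minors_nonneg (set_val A)].

(* The points of GL_k^+ \ Mat_{k,n}^{>=0}, identified with row spans. *)
Definition Gr_tnn : set Gr := rowspan @` Mat_tnn.

End Grassmannian.

Section Amplituhedron.
Variables (R : realType) (n k m : nat) (Z : 'M[R]_(k + m, n)).

(* The graph of the map rowspan V |-> rowspan (V Z^T) from [Gr_tnn] to
   Gr_k(R^(k+m)). When the maximal minors of Z are positive, V Z^T has rank k
   for every V in [Mat_tnn], so that a W as below always exists. *)
Definition Ztilde (P : Gr R k n) (Q : Gr R k (k + m)) : Prop :=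
  exists (V : Mat R k n) (W : Mat R k (k + m)),
    [/\ Mat_tnn V, P = rowspan V, set_val W = set_val V *m Z^T & Q = rowspan W].

Definition amplituhedron : set (Gr R k (k + m)) :=
  [set Q | exists2 P, Gr_tnn P & Ztilde P Q].

End Amplituhedron.

(* Main.v *)
Require Import Defs.
From mathcomp Require Import all_boot all_order all_algebra.
From mathcomp Require Import fingroup perm generic_quotient.
From mathcomp Require Import all_classical all_reals all_analysis.
From mathcomp Require Import ring lra zify.
Import Order.TTheory GRing.Theory Num.Theory.
Import numFieldNormedType.Exports.
Set Implicit Arguments.
Unset Strict Implicit.
Unset Printing Implicit Defensive.
Local Open Scope ring_scope.

(** The proof finds an affine chart of the Grassmannian in which the
    amplituhedron is a compact set that a linear flow, diagonal with positive
    integer weights, pushes into its own interior; such a set is homeomorphic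
    to a ball because every flow line leaves it exactly once.

    Put N = k + m and identify a row vector of length N + 1 with a polynomial
    of degree at most N. The flow comes from the substitutions
      x |-> (1+s)/2 x + (1-s)/2 y,  y |-> (1-s)/2 x + (1+s)/2 y   (0 < s < 1)
    on binary forms of degree N. They multiply the eigenvector
    (x+y)^(N-j) (x-y)^j by s^j, and their matrices are totally positive
    ([symmx_totally_positive]), so they send a totally nonnegative
    subspace to one all of whose maximal minors are positive. The eigenvector
    with the smallest eigenvalue, (x-y)^N, has coefficients of alternating
    signs. So has the kernel of Z, by Cramer's rule; rescaling the coordinates
    by positive numbers, which preserves total nonnegativity, makes the two
    agree ([scaled_transpose_factor]). Then Z kills exactly the last
    eigenvector, and the flow descends to the target of Z.

    Write V = [a | b | c] in the eigenbasis, with blocks of k, m and 1 columns.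
    By the Cauchy-Binet formula det a is a sum of products of maximal minors
    of V with maximal minors of the first k columns of the change of basis,
    and the latter are positive ([frame_minor_gt0]); so a is invertible for
    every totally nonnegative V of rank k, and a^-1 b is a coordinate on the
    whole amplituhedron. Its set of values [cell] is the image of the slice of
    totally nonnegative V with a = 1. That slice is compact because its entries
    are linear in its maximal minors, which are bounded by the same sum
    ([slice_entry_bound]). The flow multiplies the (i, j) entry of a^-1 b by
    s^(k+j-i), and k + j - i > 0. Its image lies in the interior of [cell]:
    moving b alone keeps finitely many positive minors positive
    ([positive_slice_nbhs]).

    Finally, for two compact sets A and B that are pushed into their own
    interiors by the same dilations, the gauges p_A and p_B are continuous and
    homogeneous, and x |-> (p_A(x) / p_B(x)).x is a homeomorphism from A to B
    ([shrinkable_homeomorphic]); the Euclidean ball is such a B. *)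

(** * The Cauchy-Binet formula and signs of minors *)

Section CauchyBinet.
Variable R : comNzRingType.

(** Leibniz expansion of the determinant of a product, with the sum over all
    maps f, injective or not, left in place. *)
Lemma det_mul_expand k n (V : 'M[R]_(k, n)) (W : 'M[R]_(n, k)) :
  \det (V *m W) =
  \sum_(f : {ffun 'I_k -> 'I_n}) (\prod_i V i (f i)) * \det (rowsub f W).
Proof.
rewrite /determinant.
transitivity (\sum_(s : 'S_k) \sum_(f : {ffun 'I_k -> 'I_n})
   (\prod_i V i (f i)) * ((-1) ^+ s * \prod_i W (f i) (s i))).
  apply: eq_bigr => s _; under eq_bigr do rewrite mxE.
  rewrite bigA_distr_bigA big_distrr /=; apply: eq_bigr => f _.
  by rewrite big_split /= mulrCA.
rewrite exchange_big; apply: eq_bigr => f _; rewrite big_distrr /=.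
by apply: eq_bigr => s _; congr (_ * (_ * _)); apply: eq_bigr => i _; rewrite mxE.
Qed.

(** The Cauchy-Binet formula, in the form obtained by averaging
    [det_mul_expand] over the permutations of the columns. Keeping all maps f,
    instead of one increasing map for each set of columns, costs a factor k!
    but avoids choosing representatives; the terms have the same signs, see
    [colsub_row_ge0]. *)
Lemma cauchy_binet_fact k n (V : 'M[R]_(k, n)) (W : 'M[R]_(n, k)) :
  k`!%:R * \det (V *m W) =
  \sum_(f : {ffun 'I_k -> 'I_n}) \det (colsub f V) * \det (rowsub f W).
Proof.
transitivity (\sum_(s : 'S_k) \sum_(f : {ffun 'I_k -> 'I_n})
   ((-1) ^+ s * \prod_i V i (f (s i))) * \det (rowsub f W)); last first.
  rewrite exchange_big; apply: eq_bigr => f _; rewrite -big_distrl /=.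
  congr (_ * _); apply: eq_bigr => s _.
  by congr (_ * _); apply: eq_bigr => i _; rewrite mxE.
rewrite mulr_natl -card_Sn -sumr_const; apply: eq_big => [s|s _].
  by rewrite inE.
rewrite det_mul_expand (reindex_inj (h := fun f : {ffun 'I_k -> 'I_n} =>
   [ffun i => f (s i)])) /=; last first.
  move=> f g /ffunP fg; apply/ffunP => i.
  by have := fg (s^-1%g i); rewrite !ffunE permKV.
apply: eq_bigr => f _; under eq_bigr do rewrite ffunE.
suff -> : rowsub [ffun i => f (s i)] W = perm_mx s *m rowsub f W.
  by rewrite det_mulmx det_perm mulrCA mulrA.
by rewrite -row_permE; apply/matrixP => i j; rewrite !mxE ffunE.
Qed.

End CauchyBinet.

Lemma increasing_cols_inj k n (f : 'I_k -> 'I_n) :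
  increasing_cols f -> injective f.
Proof.
move=> fI i j eq_f; apply: val_inj; case: (ltngtP i j) => // /fI.
  by rewrite eq_f ltnn.
by rewrite eq_f ltnn.
Qed.

Lemma sort_cols k n (f : 'I_k -> 'I_n) : injective f ->
  exists s : 'S_k, increasing_cols (f \o s).
Proof.
move=> fI; pose t := [tuple f i | i < k].
pose le (a b : 'I_n) := (a <= b)%N.
have /tuple_permP[s Es] : perm_eq (sort le t) t by rewrite perm_sort.
exists s => i j ij /=.
have le_tr : transitive le by move=> a b c; exact: leq_trans.
have srt : sorted le (sort le t) by apply: sort_sorted => a b; exact: leq_total.
have Enth (l : 'I_k) : nth (f i) (sort le t) l = f (s l).
  by rewrite Es -tnth_nth !tnth_mktuple.
have ls (l : 'I_k) : (l < size (sort le t))%N by rewrite size_sort size_tuple.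
have := sorted_ltn_nth le_tr (f i) srt i j (ls i) (ls j) ij.
rewrite !Enth /le leq_eqVlt => /orP[/eqP/val_inj/fI/perm_inj E|//].
by rewrite E ltnn in ij.
Qed.

Section Positivity.
Variable R : realType.
Implicit Types k n : nat.

(** Sorting f multiplies both minors by the same sign, and both vanish if f is
    not injective. *)
Lemma colsub_row_ge0 k n (V : 'M[R]_(k, n)) (W : 'M[R]_(n, k)) :
  (forall f : 'I_k -> 'I_n, increasing_cols f ->
    0 <= \det (colsub f V) * \det (rowsub f W)) ->
  forall f : 'I_k -> 'I_n, 0 <= \det (colsub f V) * \det (rowsub f W).
Proof.
move=> VW f; have [/injectiveP/sort_cols[s /VW]|] := boolP (injectiveb f).
  have -> : colsub (f \o s) V = col_perm s (colsub f V).
    by apply/matrixP => i j; rewrite !mxE.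
  have -> : rowsub (f \o s) W = row_perm s (rowsub f W).
    by apply/matrixP => i j; rewrite !mxE.
  rewrite col_permE row_permE !det_mulmx !det_perm odd_permV.
  by rewrite -mulrA [X in _ * X]mulrA -expr2 sqrr_sign mul1r.
move=> /injectivePn[i [j ij fij]]; have -> : \det (rowsub f W) = 0.
  by apply: (determinant_alternate ij) => l; rewrite !mxE fij.
by rewrite mulr0.
Qed.

Lemma det_mul_gt0 k n (V : 'M[R]_(k, n)) (W : 'M[R]_(n, k)) :
  (forall f : 'I_k -> 'I_n, increasing_cols f ->
    0 <= \det (colsub f V) * \det (rowsub f W)) ->
  (exists f : 'I_k -> 'I_n, 0 < \det (colsub f V) * \det (rowsub f W)) ->
  0 < \det (V *m W).
Proof.
move=> /colsub_row_ge0 VW [f f0].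
have k0 : 0 < k`!%:R :> R by rewrite ltr0n fact_gt0.
rewrite -(pmulr_rgt0 _ k0) cauchy_binet_fact.
rewrite (bigD1 [ffun i => f i]) //= ltr_pwDl ?sumr_ge0 //.
have -> : colsub [ffun i => f i] V = colsub f V.
  by apply/matrixP => i j; rewrite !mxE ffunE.
suff -> : rowsub [ffun i => f i] W = rowsub f W by [].
by apply/matrixP => i j; rewrite !mxE ffunE.
Qed.

Lemma exists_minor_neq0 k n (V : 'M[R]_(k, n)) (W : 'M[R]_(n, k)) :
  \det (V *m W) != 0 ->
  exists2 f : 'I_k -> 'I_n, increasing_cols f & \det (colsub f V) != 0.
Proof.
move=> VW; apply: contrapT => nf; move/eqP: VW; apply.
have k0 : k`!%:R != 0 :> R by rewrite pnatr_eq0 -lt0n fact_gt0.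
apply: (mulfI k0); rewrite cauchy_binet_fact mulr0 big1 // => f _.
have [/injectiveP/sort_cols[s fs]|] := boolP (injectiveb f).
  have [E|] := eqVneq (\det (colsub (f \o s) V)) 0; last first.
    by move=> E; case: nf; exists (f \o s).
  move: E; have -> : colsub (f \o s) V = col_perm s (colsub f V).
    by apply/matrixP => i j; rewrite !mxE.
  rewrite col_permE det_mulmx det_perm => /eqP.
  by rewrite mulf_eq0 signr_eq0 orbF => /eqP->; rewrite mul0r.
move=> /injectivePn[i [j ij fij]]; have -> : \det (rowsub f W) = 0.
  by apply: (determinant_alternate ij) => l; rewrite !mxE fij.
by rewrite mulr0.
Qed.

End Positivity.

(** * Symmetric powers of 2 x 2 matrices *)

Section SymmetricPower.
Variable R : comNzRingType.
Implicit Types (N : nat) (al be ga de c : R).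

(** The action of the 2 x 2 matrix (al, be; ga, de) on binary forms of degree
    N, dehomogenized at y = 1, by right multiplication on coefficient vectors. *)
Definition symmx N al be ga de : 'M[R]_N.+1 :=
  \matrix_(i, j) ((al *: 'X + be%:P) ^+ i * (ga *: 'X + de%:P) ^+ (N - i))`_j.

(** Substitution of X and Y for the two variables of the homogenization, of
    degree N, of P. *)
Definition homog N (P X Y : {poly R}) : {poly R} :=
  \sum_(j < N.+1) P`_j *: (X ^+ j * Y ^+ (N - j)).

Lemma homog_linear_mul N (P X Y : {poly R}) al be : (size P <= N.+1)%N ->
  homog N.+1 ((al *: 'X + be%:P) * P) X Y = (al *: X + be *: Y) * homog N P X Y.
Proof.
move=> sP; rewrite /homog !mulrDl !big_distrr /=.
under eq_bigr do rewrite coefD scalerDl.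
rewrite big_split /=; congr (_ + _).
  rewrite big_ord_recl /= -scalerAl coefZ coefXM mulr0 scale0r add0r.
  apply: eq_bigr => j _; rewrite -scalerAl coefZ coefXM /= subSS exprS.
  by rewrite -scalerAr scalerA mulrA.
rewrite big_ord_recr /= coefCM (nth_default _ sP) mulr0 scale0r addr0.
apply: eq_bigr => j _; rewrite coefCM subSn; last by rewrite -ltnS.
by rewrite exprS -scalerAl -scalerAr scalerA mulrCA.
Qed.

Lemma size_linear_pow al be i : (size ((al *: 'X + be%:P) ^+ i) <= i.+1)%N.
Proof.
elim: i => [|i IH]; first by rewrite expr0 size_poly1.
rewrite exprS; apply: leq_trans (size_polyMleq _ _) _.
have s2 : (size (al *: 'X + be%:P : {poly R})%R <= 2)%N.
  apply: leq_trans (size_polyD _ _) _; rewrite geq_max.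
  apply/andP; split; last by rewrite (leq_trans (size_polyC_leq1 _)).
  by apply: leq_trans (size_scale_leq _ _) _; rewrite size_polyX.
by have := leq_add s2 IH; case: (size _ + size _)%N.
Qed.

Lemma homog_pow (X Y : {poly R}) al be ga de i l :
  homog (i + l) ((al *: 'X + be%:P) ^+ i * (ga *: 'X + de%:P) ^+ l) X Y =
  (al *: X + be *: Y) ^+ i * (ga *: X + de *: Y) ^+ l.
Proof.
elim: i => [|i IH].
  rewrite !expr0 !mul1r add0n; elim: l => [|l IH].
    by rewrite !expr0 /homog big_ord1 /= !expr0 coef1 mulr1 scale1r.
  by rewrite !exprS homog_linear_mul ?size_linear_pow // IH.
rewrite !exprS -!mulrA addSn homog_linear_mul ?IH //.
apply: leq_trans (size_polyMleq _ _) _.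
have := leq_add (size_linear_pow al be i) (size_linear_pow ga de l).
by rewrite addSn addnS; case: (size _ + size _)%N.
Qed.

(** Composition of substitutions: the N-th symmetric power is functorial. All
    matrix factorizations below are thereby reduced to identities between
    2 x 2 matrices. *)
Lemma symmx_mul N al be ga de al' be' ga' de' :
  symmx N al be ga de *m symmx N al' be' ga' de' =
  symmx N (al * al' + be * ga') (al * be' + be * de')
          (ga * al' + de * ga') (ga * be' + de * de').
Proof.
apply/matrixP => i j; rewrite !mxE.
have iN : (i <= N)%N by rewrite -ltnS.
set X := al' *: 'X + be'%:P; set Y := ga' *: 'X + de'%:P.
have E a b : a *: X + b *: Y = (a * al' + b * ga') *: 'X + (a * be' + b * de')%:P.
  rewrite !scalerDr !scalerA scalerDl polyCD !polyCM -!mul_polyC addrACA.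
  by rewrite !polyCM.
have := homog_pow X Y al be ga de i (N - i); rewrite subnKC // !E => <-.
rewrite coef_sum; apply: eq_bigr => l _.
by rewrite !mxE coefZ.
Qed.

Lemma symmx_diag N al de :
  symmx N al 0 0 de = diag_mx (\row_j (al ^+ j * de ^+ (N - j))).
Proof.
apply/matrixP => i j; rewrite !mxE addr0 scale0r add0r exprZn -polyC_exp.
rewrite -scalerAl coefZ coefMC coefXn.
have [->|ne] := eqVneq i j; first by rewrite eqxx mul1r mulr1n.
rewrite (_ : (j == i :> nat) = false) ?mul0r ?mulr0 ?mulr0n //.
by apply/negbTE; rewrite eq_sym.
Qed.

Lemma symmx1 N : symmx N 1 0 0 1 = 1%:M.
Proof.
rewrite symmx_diag; apply/matrixP => i j; rewrite !mxE !expr1n mulr1.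
by [].
Qed.

Definition pascal N c : 'M[R]_N.+1 :=
  \matrix_(i, j) (c ^+ (i - j) *+ 'C(i, j)).

Lemma symmx_pascal N c : symmx N 1 c 0 1 = pascal N c.
Proof.
apply/matrixP => i j; rewrite !mxE scale1r scale0r add0r expr1n mulr1 addrC.
rewrite exprDn coef_sum.
have -> : \sum_(l < i.+1) ((c%:P ^+ (i - l) * 'X ^+ l) *+ 'C(i, l))`_j =
  \sum_(l < i.+1) if l == j :> nat then c ^+ (i - j) *+ 'C(i, j) else 0.
  apply: eq_bigr => l _; rewrite coefMn -polyC_exp coefCM coefXn eq_sym.
  by case: eqP => [->|]; rewrite ?mulr1 // mulr0 mul0rn.
rewrite -big_mkcond /=; have [ji|ij] := leqP j i.
  by rewrite (big_pred1 (Ordinal (ji : (j < i.+1)%N))).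
by rewrite bin_small // mulr0n big1.
Qed.

(** The upper unipotent symmetric power is the transpose of the lower one up to
    scaling of rows and columns by binomial coefficients, since
    C(N,i) C(N-i,j-i) = C(N,j) C(j,i). Positivity of its minors thus follows
    from that of the Pascal matrix. *)
Lemma symmx_pascal_tr N c i j :
  symmx N 1 0 c 1 i j *+ 'C(N, i) = pascal N c j i *+ 'C(N, j).
Proof.
rewrite !mxE addr0 scale1r coefXnM.
have iN : (i <= N)%N by rewrite -ltnS.
have jN : (j <= N)%N by rewrite -ltnS.
case: ltnP => [ji|ij]; first by rewrite (bin_small ji) mulr0n !mul0rn.
have -> : ((c *: 'X + 1%:P) ^+ (N - i))`_(j - i) = c ^+ (j - i) *+ 'C(N - i, j - i).
  rewrite addrC exprDn coef_sum.
  have -> : \sum_(l < (N - i).+1)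
      ((1%:P ^+ (N - i - l) * (c *: 'X) ^+ l) *+ 'C(N - i, l))`_(j - i) =
    \sum_(l < (N - i).+1)
      if l == (j - i)%N :> nat then c ^+ (j - i) *+ 'C(N - i, j - i) else 0.
    apply: eq_bigr => l _; rewrite coefMn expr1n mul1r exprZn coefZ coefXn eq_sym.
    by case: eqP => [->|]; rewrite ?mulr1 // mulr0 mul0rn.
  rewrite -big_mkcond /=.
  by rewrite (big_pred1 (Ordinal (leq_sub2r i jN : (j - i < (N - i).+1)%N))).
rewrite -!mulrnA; congr (_ *+ _).
(* Both sides times i! (j-i)! (N-j)! equal N!. *)
have B a b : (b <= a)%N -> 'C(a, b) * b`! * (a - b)`! = a`!.
  by move=> /bin_fact <-; rewrite mulnA.
have f0 := fact_gt0; apply/eqP.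
rewrite -(eqn_pmul2r (f0 i)) -(eqn_pmul2r (f0 (j - i)%N)) -(eqn_pmul2r (f0 (N - j)%N)).
have := B _ _ jN; have := B _ _ iN; have := B _ _ ij; have := B _ _ (leq_sub2r i jN).
rewrite subnBA // subnK // => E1 E2 E3 E4; apply/eqP.
transitivity N`!; first by rewrite -E3 -E1; nia.
by rewrite -E4 -E2; nia.
Qed.

End SymmetricPower.

(** * Total positivity of the symmetric powers *)

Section ScaledMinors.
Variable R : comNzRingType.

Lemma det_mul_expand_col k n (V : 'M[R]_(k, n)) (W : 'M[R]_(n, k)) :
  \det (V *m W) =
  \sum_(f : {ffun 'I_k -> 'I_n}) \det (colsub f V) * \prod_i W (f i) i.
Proof.
rewrite -det_tr trmx_mul det_mul_expand; apply: eq_bigr => f _.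
rewrite mulrC -[in RHS]det_tr; congr (\det _ * _).
  by apply/matrixP => i j; rewrite !mxE.
by apply: eq_bigr => i _; rewrite mxE.
Qed.

Lemma det_scale_rows_cols k (x y : 'I_k -> R) (M : 'M[R]_k) :
  \det (\matrix_(i, j) (x i * M i j * y j)) =
  (\prod_i x i) * \det M * \prod_i y i.
Proof.
have -> : \matrix_(i, j) (x i * M i j * y j) =
    diag_mx (\row_i x i) *m M *m diag_mx (\row_j y j).
  by apply/matrixP => i j; rewrite mul_diag_mx mul_mx_diag !mxE.
rewrite !det_mulmx !det_diag; congr (_ * _ * _).
  by apply: eq_bigr => i _; rewrite mxE.
by apply: eq_bigr => i _; rewrite mxE.
Qed.

End ScaledMinors.

Section TotalPositivity.
Variable R : realType.
Implicit Types (k n N r : nat) (c : R).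

(** A weakly increasing choice of columns is increasing or repeats a column. *)
Lemma minor_weakly_increasing k n (V : 'M[R]_(k, n)) (f : 'I_k -> 'I_n) :
  max_minors_nonneg V -> (forall i j : 'I_k, (i < j)%N -> (f i <= f j)%N) ->
  0 <= \det (colsub f V).
Proof.
move=> V0 fle; have [/injectiveP fI|] := boolP (injectiveb f).
  apply: V0 => i j ij; rewrite ltn_neqAle fle // andbT.
  by apply: contraTneq ij => /val_inj/fI->; rewrite ltnn.
move=> /injectivePn[i [j ij fij]].
rewrite -det_tr (determinant_alternate ij) // => l.
by rewrite !mxE fij.
Qed.

(** A column of the product combines two consecutive columns of V, so a minor
    of the product is a nonnegative combination of minors of V on weakly
    increasing choices of columns. *)
Lemma max_minors_nonneg_mul_bidiag k n (V : 'M[R]_(k, n)) (E : 'M[R]_n) :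
  max_minors_nonneg V -> (forall i j, 0 <= E i j) ->
  (forall i j : 'I_n, E i j != 0 -> (j <= i <= j.+1)%N) ->
  max_minors_nonneg (V *m E).
Proof.
move=> V0 E0 Eb g gI; have -> : colsub g (V *m E) = V *m colsub g E.
  by rewrite mulmx_colsub.
rewrite det_mul_expand_col sumr_ge0 // => f _.
have [/forallP fb|] := boolP [forall i, E (f i) (g i) != 0]; last first.
  move=> /forallPn[i]; rewrite negbK => /eqP Ei.
  by rewrite (bigD1 i) //= mxE Ei mul0r mulr0.
rewrite mulr_ge0 ?prodr_ge0 // => [|i _]; last by rewrite mxE.
apply: minor_weakly_increasing => // i j /gI ij.
have /andP[_ fi] := Eb _ _ (fb i); have /andP[fj _] := Eb _ _ (fb j).
exact: leq_trans fi (leq_trans ij fj).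
Qed.


Lemma increasing_cols_ge k n (f : 'I_k -> 'I_n) (i : 'I_k) :
  increasing_cols f -> (i <= f i)%N.
Proof.
move=> fI; case: i => i; elim: i => [//|i IH] ik.
apply: leq_ltn_trans (IH (ltnW ik)) _.
by apply: fI => /=.
Qed.

Lemma increasing_perm1 k (s : 'S_k) : increasing_cols s -> s = 1%g.
Proof.
move=> sI; have sVI : increasing_cols (s^-1)%g.
  move=> i j ij; case: (ltngtP (s^-1 i)%g (s^-1 j)%g) => // [/sI|/val_inj/perm_inj E].
    by rewrite !permKV ltnNge (ltnW ij).
  by rewrite E ltnn in ij.
apply/permP => i; rewrite perm1; apply: val_inj; apply/eqP.
rewrite eqn_leq (increasing_cols_ge i sI) andbT.
by have := increasing_cols_ge (s i) sVI; rewrite permK.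
Qed.

(** A Leibniz term for s is nonzero only if f = g o s, which forces s to be
    increasing, hence trivial. *)
Lemma max_minors_nonneg_rowsub1 k n (f : 'I_k -> 'I_n) :
  increasing_cols f -> max_minors_nonneg (rowsub f (1%:M : 'M[R]_n)).
Proof.
move=> fI g gI; rewrite sumr_ge0 // => s _.
have [/forallP h|] := boolP [forall i, f i == g (s i)]; last first.
  move=> /forallPn[i fi]; rewrite (bigD1 i) //= !mxE (negbTE fi).
  by rewrite mul0r mulr0.
have -> : s = 1%g.
  apply: increasing_perm1 => i j /fI; rewrite !(eqP (h _)) => gij.
  case: (ltngtP (s i) (s j)) => // [/gI|/val_inj E].
    by rewrite ltnNge (ltnW gij).
  by rewrite E ltnn in gij.
by rewrite odd_perm1 expr0 mul1r prodr_ge0 // => i _; rewrite !mxE ler0n.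
Qed.

(** A partial Taylor shift: if p has degree less than r, then p + x^r q(x) |-> p + x^r q(x + c). Going down
    from r = N + 1 to r = 0 is the Horner scheme, whose steps are bidiagonal. *)
Definition pascal_from r N c : 'M[R]_N.+1 := \matrix_(i, j)
  (if (i < r)%N then (i == j)%:R
   else if (j < r)%N then 0 else c ^+ (i - j) *+ 'C(i - r, j - r)).

Definition pascal_step r N c : 'M[R]_N.+1 := \matrix_(i, j)
  ((i == j)%:R + (if ((r <= j) && (i == j.+1 :> nat))%N then c else 0)).

Lemma pascal_fromS r N c :
  pascal_from r N c = pascal_from r.+1 N c *m pascal_step r N c.
Proof.
apply/matrixP => i j; rewrite [RHS]mxE.
pose p (a b : nat) := if (a < r.+1)%N then (a == b)%:R
   else if (b < r.+1)%N then 0 else c ^+ (a - b) *+ 'C(a - r.+1, b - r.+1) : R.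
transitivity (p i j + if (r <= j)%N then p i j.+1 * c else 0).
  rewrite mxE /p -[i == j]/(i == j :> nat) !ltnS.
  case: (ltngtP i r) => ir /=.
  - case: (leqP r j) => rj; last by rewrite addr0.
    by rewrite (_ : (i == j.+1 :> nat) = false) ?mul0r ?addr0 //; lia.
  - case: (ltngtP j r) => jr /=.
    + by rewrite addr0.
    + rewrite subSS mulrnAl -exprSr.
      have [ji|ij] := leqP j.+1 i; last first.
        rewrite (@bin_small (i - r.+1) (j - r)) ?mulr0n ?addr0; last by lia.
        have [->|ne] := eqVneq (i : nat) (j : nat); first by rewrite !binn.
        by rewrite !bin_small //; lia.
      have -> : (i - j.+1).+1 = (i - j)%N by lia.
      have -> : (i - r = (i - r.+1).+1)%N by lia.
      have -> : (j - r = (j - r.+1).+1)%N by lia.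
      by rewrite binS mulrnDr addrC.
    + rewrite jr add0r !subnn !bin0 !mulr1n -exprSr.
      by congr (_ ^+ _); lia.
  - rewrite ir; case: (ltngtP j r) => jr /=.
    + by rewrite addr0.
    + rewrite bin_small ?mulr0n; last by lia.
      by rewrite ltn_eqF ?mul0r ?addr0 // ltnW.
    + by rewrite jr ltn_eqF // mul0r addr0 !subnn bin0 mulr1n.
have Ep a : pascal_from r.+1 N c i a = p i a by rewrite mxE.
under eq_bigr do rewrite Ep mxE mulrDr.
rewrite big_split /=; congr (_ + _).
  by rewrite (bigD1 j) //= eqxx mulr1 big1 ?addr0 // => a /negbTE->; rewrite mulr0.
case: leqP => rj /=; last by rewrite big1 // => a _; rewrite mulr0.
have [jN|Nj] := ltnP j N.
  have jN1 : (j.+1 < N.+1)%N by [].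
  rewrite (bigD1 (Ordinal jN1)) //= eqxx big1 ?addr0 // => a.
  by rewrite -val_eqE /= => /negbTE->; rewrite mulr0.
rewrite big1 => [|a _]; last first.
  by rewrite ltn_eqF ?mulr0 //; apply: leq_trans (ltn_ord a) _.
have iN := ltn_ord i; rewrite /p; case: ltnP => ir.
  by rewrite ltn_eqF ?mul0r //; lia.
by case: ifP => _; rewrite ?mul0r // bin_small ?mulr0n ?mul0r //; lia.
Qed.

(** The Pascal matrix is a product of nonnegative bidiagonal matrices. *)
Lemma pascal_totally_nonneg k N c (f : 'I_k -> 'I_N.+1) : 0 <= c ->
  increasing_cols f -> max_minors_nonneg (rowsub f (pascal N c)).
Proof.
move=> c0 fI.
suff H d r : (r + d = N.+1)%N -> max_minors_nonneg (rowsub f (pascal_from r N c)).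
  rewrite (_ : pascal N c = pascal_from 0 N c); first exact: (H N.+1).
  by apply/matrixP => i j; rewrite !mxE !subn0.
elim: d r => [|d IH] r.
  rewrite addn0 => ->; rewrite (_ : pascal_from _ _ _ = 1%:M).
    exact: max_minors_nonneg_rowsub1.
  by apply/matrixP => i j; rewrite !mxE ltn_ord.
rewrite addnS -addSn => /IH H.
rewrite pascal_fromS -mul_rowsub_mx; apply: max_minors_nonneg_mul_bidiag => //.
  by move=> i j; rewrite mxE addr_ge0 // ?ler0n //; case: ifP.
move=> i j; rewrite mxE -[i == j]/(i == j :> nat).
have [->|_] := eqVneq (i : nat) (j : nat); first by lia.
by rewrite add0r; case: ifP => [/andP[_ /eqP->] _|_ /eqP//]; lia.
Qed.

(** The falling factorial of order b is a monic polynomial of degree b; this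
    turns the first columns of the Pascal matrix into a Vandermonde matrix. *)
Lemma ffact_horner a b :
  (a ^_ b)%:R = (\prod_(l < b) ('X - l%:R%:P)).[a%:R] :> R.
Proof.
elim: b => [|b IH]; first by rewrite ffactn0 big_ord0 hornerC.
rewrite big_ord_recr hornerM -IH ffactnSr natrM !hornerE /=.
have [ba|ab] := leqP b a; first by rewrite natrB.
by rewrite ffact_small // !mul0r.
Qed.

Lemma det_ffact_gt0 k (a : 'I_k -> nat) :
  (forall i j : 'I_k, (i < j)%N -> (a i < a j)%N) ->
  0 < \det (\matrix_(i < k, j < k) ((a i ^_ j)%:R : R)).
Proof.
move=> aI; pose P (j : nat) : {poly R} := \prod_(l < j) ('X - l%:R%:P).
have sP j : size (P j) = j.+1.
  by rewrite /P size_prod_XsubC; congr _.+1; rewrite /index_enum -enumT size_enum_ord.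
have mP j : P j \is monic by exact: monic_prod_XsubC.
pose V := Vandermonde k (\row_(i < k) ((a i)%:R : R)).
pose Q : 'M[R]_k := \matrix_(i, j) (P i)`_j.
have -> : \matrix_(i < k, j < k) ((a i ^_ j)%:R : R) = V^T *m Q^T.
  apply/matrixP => i j; rewrite !mxE ffact_horner -/(P j).
  rewrite (@horner_coef_wide _ k) ?sP //.
  by apply: eq_bigr => l _; rewrite !mxE mulrC.
rewrite det_mulmx !det_tr det_Vandermonde det_trig; last first.
  apply/is_trig_mxP => i j ij; rewrite mxE nth_default //.
  by rewrite sP.
rewrite mulr_gt0 ?prodr_gt0 // => i _.
  by rewrite prodr_gt0 // => j ij; rewrite !mxE subr_gt0 ltr_nat aI.
rewrite mxE (_ : _`_i = 1) //.
by have /monicP := mP i; rewrite lead_coefE sP.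
Qed.

(** The entry in row i and column b is c^i c^-b / b! times the falling
    factorial of i of order b, so the minor is a scaled Vandermonde
    determinant. *)
Lemma pascal_initial_minor_gt0 k N c (f g : 'I_k -> 'I_N.+1) : 0 < c ->
  increasing_cols f -> (forall b, g b = b :> nat) ->
  0 < \det (mxsub f g (pascal N c)).
Proof.
move=> c0 fI gE.
have c00 : c != 0 by rewrite gt_eqF.
have -> : mxsub f g (pascal N c) = \matrix_(i, j)
   (c ^+ f i * (\matrix_(i < k, j < k) (((f i : nat) ^_ j)%:R : R)) i j
     * (c ^+ j * j`!%:R)^-1).
  apply/matrixP => i j; rewrite !mxE gE -bin_ffact natrM invfM.
  have fj : j`!%:R != 0 :> R by rewrite pnatr_eq0 -lt0n fact_gt0.
  have [ji|ij] := leqP j (f i); last by rewrite bin_small // !(mul0r, mulr0).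
  have -> : c ^+ f i = c ^+ (f i - j) * c ^+ j by rewrite -exprD subnK.
  by rewrite -mulr_natr; field; rewrite fj expf_neq0.
rewrite det_scale_rows_cols !mulr_gt0 ?prodr_gt0 //.
- by move=> i _; rewrite exprn_gt0.
- by apply: det_ffact_gt0 => i j; exact: fI.
- by move=> i _; rewrite invr_gt0 mulr_gt0 ?exprn_gt0 // ltr0n fact_gt0.
Qed.

Lemma symmx_diag_right k N c (al de : R) (f g : 'I_k -> 'I_N.+1) :
  0 < al -> 0 < de -> exists2 x, 0 < x &
  \det (mxsub f g (symmx N 1 0 c 1 *m symmx N al 0 0 de)) =
  x * \det (mxsub g f (pascal N c)).
Proof.
move=> al0 de0; pose C (j : 'I_N.+1) := 'C(N, j)%:R : R.
have C0 j : 0 < C j by rewrite ltr0n bin_gt0 -ltnS.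
pose x (i : 'I_k) := (C (f i))^-1.
pose y (i : 'I_k) := C (g i) * (al ^+ g i * de ^+ (N - g i)).
have x0 i : 0 < x i by rewrite invr_gt0.
have y0 i : 0 < y i by rewrite !mulr_gt0 ?exprn_gt0.
exists ((\prod_i x i) * \prod_i y i); first by rewrite mulr_gt0 ?prodr_gt0.
rewrite -[\det (mxsub g f _)]det_tr mulrAC -det_scale_rows_cols; congr (\det _).
apply/matrixP => i j.
rewrite symmx_diag mul_mx_diag; move: (symmx_pascal_tr c (f i) (g j)) => E.
rewrite mxE [in LHS]mxE [in RHS]mxE; set a := symmx _ _ _ _ _ _ _ in E *.
rewrite [(_^T) _ _]mxE [mxsub _ _ _ _ _]mxE; set b := pascal _ _ _ _ in E *.
rewrite mxE /x /y -[a](mulfK (lt0r_neq0 (C0 (f i)))) mulr_natr E -mulr_natr.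
by rewrite -/(C _); ring.
Qed.

(** Factor the 2 x 2 matrix (p, q; q, p) as lower unipotent, upper unipotent,
    diagonal. By Cauchy-Binet a minor is a sum of nonnegative terms, and the
    term of the first k indices is positive. *)
Lemma symmx_totally_positive k N (p q : R) (f g h : 'I_k -> 'I_N.+1) :
  0 < q < p -> increasing_cols f -> increasing_cols g ->
  (forall b, h b = b :> nat) ->
  0 < \det (mxsub f g (symmx N p q q p)).
Proof.
move=> /andP[q0 qp] fI gI hE; have p0 := lt_trans q0 qp.
(* (p, q; q, p) = (1, a; 0, 1) (1, 0; c, 1) (al, 0; 0, p). *)
pose al := p - q * q / p.
have al0 : 0 < al by rewrite subr_gt0 ltr_pdivrMr // ltr_pM // ltW.
pose a := q / p; pose c := q / al.
have a0 : 0 < a by rewrite divr_gt0.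
have c0 : 0 < c by rewrite divr_gt0.
have -> : symmx N p q q p =
    pascal N a *m (symmx N 1 0 c 1 *m symmx N al 0 0 p).
  rewrite -symmx_pascal !symmx_mul.
  have pn0 := lt0r_neq0 p0; have aln0 := lt0r_neq0 al0.
  have E1 : c * al = q by rewrite /c divfK.
  have E2 : a * p = q by rewrite /a divfK.
  have E3 : al + a * q = p by rewrite /al /a addrC mulrAC addrCA subrr addr0.
  congr symmx; rewrite ?(mul0r, mulr0, mul1r, mulr1, add0r, addr0) //.
  by rewrite E1 E3.
have U f' g' : exists2 x, 0 < x & \det (mxsub f' g' (symmx N 1 0 c 1 *m symmx N al 0 0 p)) = x * \det (mxsub g' f' (pascal N c)).
  exact: symmx_diag_right.
rewrite mxsub_mul; apply: det_mul_gt0 => [l lI|].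
  apply: mulr_ge0; first exact: (pascal_totally_nonneg (ltW a0) fI lI).
  rewrite -mxsubrc; have [x x0 ->] := U _ l g.
  rewrite mulr_ge0 ?(ltW x0) //  mxsubcr.
  exact: (pascal_totally_nonneg (ltW c0) gI lI).
exists h; apply: mulr_gt0.
  by rewrite -mxsubcr; apply: pascal_initial_minor_gt0.
rewrite -mxsubrc; have [x x0 ->] := U _ h g.
by rewrite mulr_gt0 // pascal_initial_minor_gt0.
Qed.

(** Factor the 2 x 2 matrix as lower unipotent times upper triangular: the
    first k columns of the product are those of the Pascal matrix times a
    triangular matrix with positive diagonal. *)
Lemma symmx_initial_minor_gt0 k N (f g : 'I_k -> 'I_N.+1) :
  increasing_cols f -> (forall b, g b = b :> nat) ->
  0 < \det (mxsub f g (symmx N (2^-1) (2^-1) (- 2^-1) (2^-1 : R))).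
Proof.
move=> fI gE; pose U : 'M[R]_N.+1 := symmx N 1 0 (- 2^-1) (2^-1).
have h0 : 0 < 2^-1 :> R by rewrite invr_gt0.
have -> : symmx N (2^-1) (2^-1) (- 2^-1) (2^-1 : R) = pascal N 1 *m U.
  by rewrite -symmx_pascal symmx_mul; congr symmx; field.
have Udiag (i : 'I_N.+1) : U i i = (2^-1) ^+ (N - i).
  rewrite mxE addr0 scale1r coefXnM ltnn subnn -horner_coef0.
  by rewrite horner_exp !hornerE /= ?mulr0 ?add0r.
have Utr (i j : 'I_N.+1) : (j < i)%N -> U i j = 0.
  by move=> ji; rewrite mxE addr0 scale1r coefXnM ji.
have gI : injective g by move=> a b /(congr1 val) /=; rewrite !gE => /val_inj.
have -> : mxsub f g (pascal N 1 *m U) =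
    mxsub f g (pascal N 1) *m mxsub g g U.
  apply/matrixP => i j; rewrite mxE [LHS]mxE [RHS]mxE.
  rewrite (bigID (mem (g @: 'I_k))) /= [X in _ + X]big1 ?addr0; last first.
    move=> l lg; rewrite Utr ?mulr0 // gE ltnNge; apply: contra lg => lj.
    have lk : (l < k)%N by apply: leq_ltn_trans lj (ltn_ord j).
    by apply/imsetP; exists (Ordinal lk) => //; apply: val_inj; rewrite /= gE.
  rewrite big_imset /=; last by move=> a b _ _; exact: gI.
  by apply: eq_big => // l _; rewrite !mxE.
rewrite det_mulmx mulr_gt0 //.
  exact: pascal_initial_minor_gt0.
rewrite -det_tr det_trig; last first.
  by apply/is_trig_mxP => i j ij; rewrite mxE [mxsub _ _ _ _ _]mxE Utr // !gE.
rewrite prodr_gt0 // => i _; rewrite mxE [mxsub _ _ _ _ _]mxE Udiag.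
by rewrite exprn_gt0.
Qed.

End TotalPositivity.

(** * The eigenbasis of the flow and the totally nonnegative slice *)

Section EigenBasis.
Variables (R : realType) (N : nat).

(** The rows are the eigenvectors of the flow: row j holds the coefficients
    of (x - 1)^j (x + 1)^(N - j). *)
Definition eig : 'M[R]_N.+1 := symmx N 1 (-1) 1 1.
Definition eig_inv : 'M[R]_N.+1 := symmx N (2^-1) (2^-1) (- 2^-1) (2^-1).
(** The last eigenvector, whose coefficients alternate in sign, is left out; it
    spans the kernel of Z once the coordinates are rescaled. The columns of [eigP] are the coordinate functions
    of the others. *)
Definition eigQ : 'M[R]_(N, N.+1) := rowsub (widen_ord (leqnSn N)) eig.
Definition eigP : 'M[R]_(N.+1, N) := colsub (widen_ord (leqnSn N)) eig_inv.
Definition flow_mx (s : R) : 'M[R]_N.+1 :=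
  symmx N ((1 + s) / 2) ((1 - s) / 2) ((1 - s) / 2) ((1 + s) / 2).

Lemma eig_invK : eig_inv *m eig = 1%:M.
Proof. by rewrite symmx_mul -symmx1; congr symmx; field. Qed.

Lemma eigK : eig *m eig_inv = 1%:M.
Proof. exact: mulmx1C eig_invK. Qed.

Lemma eigQP : eigQ *m eigP = 1%:M.
Proof.
by rewrite -mxsub_mul eigK; apply/matrixP => i j; rewrite !mxE.
Qed.

Lemma flow_mx_eigP s : flow_mx s *m eigP = eigP *m diag_mx (\row_j s ^+ j).
Proof.
have E : flow_mx s *m eig_inv = eig_inv *m diag_mx (\row_(j < N.+1) s ^+ j).
  have -> : diag_mx (\row_(j < N.+1) s ^+ j) = symmx N s 0 0 1.
    rewrite symmx_diag; congr diag_mx; apply/rowP => j.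
    by rewrite !mxE expr1n mulr1.
  by rewrite !symmx_mul; congr symmx; field.
apply/matrixP => i j; rewrite mul_mx_diag.
have := congr1 (fun M : 'M[R]_N.+1 => M i (widen_ord (leqnSn N) j)) E.
rewrite mul_mx_diag mulmx_colsub [X in _ -> X = _]mxE => ->.
by rewrite !mxE.
Qed.

Lemma eig_last i :
  eig ord_max i = (-1) ^+ (N - i) *+ 'C(N, i).
Proof.
have -> : eig ord_max i = symmx N 1 (-1) 0 1 ord_max i.
  by rewrite !mxE /= subnn !expr0.
by rewrite symmx_pascal mxE.
Qed.

(** Cramer's rule: expand the determinant of Z with its row r repeated. *)
Lemma signed_minors_kernel (Z : 'M[R]_(N, N.+1)) r :
  \sum_(i < N.+1) (-1) ^+ (N - i) * \det (colsub (lift i) Z) * Z r i = 0.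
Proof.
pose A : 'M[R]_N.+1 := \matrix_(a, b)
  (if unlift ord0 a is Some a' then Z a' b else Z r b).
have : \det A = 0.
  apply: (@determinant_alternate _ _ _ ord0 (lift ord0 r)) => [//|b].
  by rewrite !mxE liftK unlift_none.
rewrite (expand_det_row _ ord0) => A0.
rewrite -[RHS](mulr0 ((-1) ^+ N)) -[X in _ = _ * X]A0 big_distrr /=.
apply: eq_bigr => i _.
have iN : (i <= N)%N by rewrite -ltnS.
rewrite mxE unlift_none /cofactor add0n.
have -> : row' ord0 (col' i A) = colsub (lift i) Z.
  by apply/matrixP => a b; rewrite !mxE liftK.
have -> : (-1) ^+ N = (-1) ^+ (N - i) * (-1) ^+ i :> R by rewrite -exprD subnK.
have sq : (-1) ^+ i * (-1) ^+ i = 1 :> R by rewrite -expr2 sqrr_sign.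
rewrite -[LHS]mul1r -[X in X * _ = _]sq.
move: ((-1) ^+ i : R) ((-1) ^+ (N - i) : R) (\det _) => x y z; ring.
Qed.

(** The kernel of Z is spanned by its signed maximal minors. Scaling the i-th
    coordinate by the i-th minor divided by C(N,i) turns it into the last
    eigenvector, up to sign, so that the scaled Z factors through the other
    N coordinate functions. *)
Lemma scaled_transpose_factor (Z : 'M[R]_(N, N.+1)) : max_minors_pos Z ->
  exists (d : 'rV[R]_N.+1) (G : 'M[R]_N),
    [/\ forall i, 0 < d 0 i, G \in unitmx & diag_mx d *m Z^T = eigP *m G].
Proof.
move=> Zp.
have liftI (i : 'I_N.+1) : increasing_cols (lift i : 'I_N -> 'I_N.+1).
  by move=> a b ab; rewrite /= /bump; lia.
(* Absolute values of the kernel of Z over those of the last eigenvector. *)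
pose d : 'rV[R]_N.+1 := \row_i (\det (colsub (lift i) Z) / 'C(N, i)%:R).
have C0 (i : 'I_N.+1) : 0 < 'C(N, i)%:R :> R by rewrite ltr0n bin_gt0 -ltnS.
have d0 i : 0 < d 0 i by rewrite mxE divr_gt0 // Zp.
pose X := diag_mx d *m Z^T.
have XE : X = eigP *m (eigQ *m X).
  have last0 r : (eig *m X) ord_max r = 0.
    rewrite -[RHS](signed_minors_kernel Z r) mxE; apply: eq_bigr => i _.
    rewrite eig_last /X mul_diag_mx !mxE -mulr_natr.
    by field; rewrite lt0r_neq0.
  rewrite -{1}[X]mul1mx -eig_invK -mulmxA mul_rowsub_mx.
  apply/matrixP => i j; rewrite [LHS]mxE [RHS]mxE big_ord_recr /= last0 mulr0 addr0.
  by apply: eq_bigr => l _; rewrite [eigP _ _]mxE [rowsub _ _ _ _]mxE.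
exists d, (eigQ *m X); split => //.
have : \det (rowsub (widen_ord (leqnSn N)) X) != 0.
  have -> : rowsub (widen_ord (leqnSn N)) X =
      diag_mx (\row_i d 0 (widen_ord (leqnSn N) i)) *m (colsub (widen_ord (leqnSn N)) Z)^T.
    by apply/matrixP => i j; rewrite /X !mul_diag_mx !mxE.
  rewrite det_mulmx det_tr det_diag lt0r_neq0 // mulr_gt0 //.
    by rewrite prodr_gt0 // => i _; rewrite mxE.
  by apply: Zp.
rewrite {1}XE -mul_rowsub_mx det_mulmx mulf_eq0 negb_or => /andP[_].
by rewrite unitmxE unitfE.
Qed.

End EigenBasis.

Section Slice.
Variables (R : realType) (k m : nat).
Notation n := (k + m).+1.
Notation C := (lsubmx (eigP R (k + m))).
Notation Y := (rsubmx (eigP R (k + m))).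

(** This is what makes the first k eigencoordinates of a totally nonnegative
    subspace of dimension k independent. *)
Lemma frame_minor_gt0 (f : 'I_k -> 'I_n) :
  increasing_cols f -> 0 < \det (rowsub f C).
Proof.
move=> fI; pose g (i : 'I_k) : 'I_n := widen_ord (leqnSn _) (lshift m i).
have -> : rowsub f C = mxsub f g (eig_inv R (k + m)).
  by apply/matrixP => i j; rewrite !mxE.
exact: symmx_initial_minor_gt0.
Qed.

Lemma full_rank_minor (V : 'M[R]_(k, n)) : \rank V = k ->
  exists2 f : 'I_k -> 'I_n, increasing_cols f & \det (colsub f V) != 0.
Proof.
move=> rV; have /row_freeP[W VW] : row_free V by rewrite /row_free rV.
by apply: (@exists_minor_neq0 _ _ _ _ W); rewrite VW det1 oner_neq0.
Qed.

Lemma tnn_pairing_gt0 (V : 'M[R]_(k, n)) (W : 'M[R]_(n, k)) : \rank V = k ->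
  max_minors_nonneg V ->
  (forall f : 'I_k -> 'I_n, increasing_cols f -> 0 < \det (rowsub f W)) ->
  0 < \det (V *m W).
Proof.
move=> rV V0 W0; apply: det_mul_gt0 => [f fI|].
  by rewrite mulr_ge0 ?V0 // ltW // W0.
have [f fI fV] := full_rank_minor rV; exists f.
by rewrite mulr_gt0 ?W0 // lt0r fV V0.
Qed.

(** Normal forms of the totally nonnegative subspaces of dimension k under
    left multiplication: the first k eigencoordinates form the identity. *)
Definition slice : set 'M[R]_(k, n) :=
  [set V | V *m C = 1%:M /\ max_minors_nonneg V].

Lemma slice_rank V : slice V -> \rank V = k.
Proof.
move=> [VC _]; apply/eqP; rewrite -[_ == _]/(row_free V).
by apply/row_freeP; exists C.
Qed.

Lemma minors_mull p (g : 'M[R]_k) (V : 'M[R]_(k, p)) f :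
  \det (colsub f (g *m V)) = \det g * \det (colsub f V).
Proof. by rewrite -mulmx_colsub det_mulmx. Qed.

Lemma slice_normalize (V : 'M[R]_(k, n)) : \rank V = k ->
  max_minors_nonneg V -> slice (invmx (V *m C) *m V).
Proof.
move=> rV V0.
have d0 : 0 < \det (V *m C) by apply: tnn_pairing_gt0 => // f; exact: frame_minor_gt0.
split; first by rewrite -mulmxA mulVmx // unitmxE unitfE lt0r_neq0.
by move=> f fI; rewrite minors_mull mulr_ge0 ?V0 // det_inv invr_ge0 ltW.
Qed.

(** After the flow, row i of V is rescaled by s^-i to return to the slice. *)
Lemma slice_flow (s : R) V : 0 < s < 1 -> slice V ->
  exists V', [/\ slice V', max_minors_pos V' &
    V' *m Y = \matrix_(i, j) (s ^+ (k + j - i) * (V *m Y) i j)].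
Proof.
move=> /andP[s0 s1] sV; have sn0 := lt0r_neq0 s0.
have [VC V0] := sV; have rV := slice_rank sV.
pose D : 'M[R]_k := diag_mx (\row_i s ^- i).
pose V' := D *m (V *m flow_mx (k + m) s).
have D0 : 0 < \det D.
  by rewrite det_diag prodr_gt0 // => i _; rewrite mxE invr_gt0 exprn_gt0.
have V'p : max_minors_pos V'.
  move=> g gI; rewrite minors_mull mulr_gt0 // -mulmx_colsub.
  apply: tnn_pairing_gt0 => // f fI; rewrite -mxsubrc.
  pose h (i : 'I_k) : 'I_n := widen_ord (leqnSn _) (lshift m i).
  by apply: (@symmx_totally_positive _ _ _ _ _ _ _ h) => //; lra.
have V'E : V' *m eigP R (k + m) =
    \matrix_(i, j) (s ^+ j / s ^+ i * (V *m eigP R (k + m)) i j).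
  rewrite -mulmxA -mulmxA flow_mx_eigP [V *m (_ *m _)]mulmxA.
  rewrite mul_diag_mx mul_mx_diag; move: (V *m eigP _ _) => W.
  by apply/matrixP => i j; rewrite !mxE; ring.
exists V'; split=> //.
  split; last by move=> f fI; exact/ltW/V'p.
  rewrite mulmx_lsub V'E; apply/matrixP => i j.
  have := congr1 (fun M : 'M[R]_k => M i j) VC; rewrite mulmx_lsub mxE => E.
  rewrite !mxE in E *; rewrite E; case: eqVneq => [->|_]; last by rewrite mulr0.
  by rewrite divff ?mulr1 // expf_neq0.
rewrite !mulmx_rsub V'E; move: (V *m eigP _ _) => W.
apply/matrixP => i j; rewrite !mxE /=; congr (_ * _).
have ij : (i <= k + j)%N by rewrite (leq_trans (ltnW (ltn_ord i))) // leq_addr.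
by rewrite -{1}(subnK ij) exprD mulfK // expf_neq0.
Qed.

(** The coordinate V Y can be prescribed freely while staying on the affine
    space V C = 1. *)
Lemma slice_shift V (M : 'M[R]_(k, m)) :
  let V' := V + (M - V *m Y) *m dsubmx (eigQ R (k + m)) in
  V *m C = 1%:M -> V' *m C = 1%:M /\ V' *m Y = M.
Proof.
move=> V' VC; have QP := eigQP R (k + m).
have QC : dsubmx (eigQ R (k + m)) *m C = 0.
  rewrite mul_dsub_mx mulmx_lsub QP; apply/matrixP => i j.
  by rewrite !mxE eq_rlshift.
have QY : dsubmx (eigQ R (k + m)) *m Y = 1%:M.
  rewrite mul_dsub_mx mulmx_rsub QP; apply/matrixP => i j.
  by rewrite !mxE eq_rshift.
rewrite /V'; split; first by rewrite mulmxDl -mulmxA QC mulmx0 addr0.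
by rewrite mulmxDl -mulmxA QY mulmx1 addrC subrK.
Qed.

Lemma slice_nonempty : exists V, slice V.
Proof.
pose g (i : 'I_k) : 'I_n := widen_ord (leqnSn _) (lshift m i).
have gI : increasing_cols g by [].
exists (invmx (rowsub g 1%:M *m C) *m rowsub g 1%:M).
apply: slice_normalize; last exact: max_minors_nonneg_rowsub1.
apply/eqP; rewrite -[_ == _]/(row_free _); apply/row_freeP.
exists (colsub g 1%:M); rewrite -mxsub_mul mulmx1; apply/matrixP => i j.
by rewrite !mxE (inj_eq (increasing_cols_inj gI)).
Qed.

End Slice.

(** * Limits of matrix expressions *)

Local Open Scope classical_set_scope.

Section MatrixLimits.
Context {R : realType} {T : Type} {F : set_system T} {FF : Filter F}.

Lemma cvg_mx m n (f : T -> 'M[R]_(m, n)) (M : 'M[R]_(m, n)) :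
  (forall i j, f x i j @[x --> F] --> M i j) -> f x @[x --> F] --> M.
Proof.
move=> fM B [P MP PB]; apply: filterS PB _.
suff : \forall x \near F, forall i j, P i j (f x i j) by [].
by apply: filter_forall => i; apply: filter_forall => j; exact: fM.
Qed.

Lemma cvg_mx_coord m n (f : T -> 'M[R]_(m, n)) (M : 'M[R]_(m, n)) i j :
  f x @[x --> F] --> M -> f x i j @[x --> F] --> M i j.
Proof.
move=> fM; apply: (cvg_comp (G := nbhs M) _ (fun A : 'M[R]_(m, n) => A i j)) => //.
exact: coord_continuous.
Qed.

Lemma cvg_exprn (f : T -> R) (a : R) n :
  f x @[x --> F] --> a -> f x ^+ n @[x --> F] --> a ^+ n.
Proof.
move=> fa; elim: n => [|n IH]; first exact: cvg_cst.
by under eq_fun do rewrite exprS; rewrite exprS; exact: cvgM.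
Qed.

Lemma cvg_sum_fin (I : finType) (f : I -> T -> R) (a : I -> R) :
  (forall i, f i x @[x --> F] --> a i) ->
  \sum_i f i x @[x --> F] --> \sum_i a i.
Proof. by move=> fa; apply: cvg_big => // -[x y]; exact: add_continuous. Qed.

Lemma cvg_prod_fin (I : finType) (f : I -> T -> R) (a : I -> R) :
  (forall i, f i x @[x --> F] --> a i) ->
  \prod_i f i x @[x --> F] --> \prod_i a i.
Proof. by move=> fa; apply: cvg_big => // -[x y]; exact: mul_continuous. Qed.

Lemma cvg_mulmx m n p (f : T -> 'M[R]_(m, n)) (g : T -> 'M[R]_(n, p))
  (A : 'M[R]_(m, n)) (B : 'M[R]_(n, p)) :
  f x @[x --> F] --> A -> g x @[x --> F] --> B ->
  f x *m g x @[x --> F] --> A *m B.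
Proof.
move=> fA gB; apply: cvg_mx => i j; under eq_fun do rewrite mxE.
rewrite mxE; apply: cvg_sum_fin => l; apply: cvgM; exact: cvg_mx_coord.
Qed.

Lemma cvg_det n (f : T -> 'M[R]_n) (A : 'M[R]_n) :
  f x @[x --> F] --> A -> \det (f x) @[x --> F] --> \det A.
Proof.
move=> fA; apply: cvg_sum_fin => s; apply: cvgMr; apply: cvg_prod_fin => i.
exact: cvg_mx_coord.
Qed.

Lemma cvg_mxsub m n p q (f : 'I_p -> 'I_m) (g : 'I_q -> 'I_n)
  (h : T -> 'M[R]_(m, n)) (A : 'M[R]_(m, n)) :
  h x @[x --> F] --> A -> mxsub f g (h x) @[x --> F] --> mxsub f g A.
Proof.
move=> hA; apply: cvg_mx => i j; under eq_fun do rewrite mxE.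
by rewrite mxE; exact: cvg_mx_coord.
Qed.

Lemma cvg_invmx n (f : T -> 'M[R]_n) (A : 'M[R]_n) : A \in unitmx ->
  f x @[x --> F] --> A -> invmx (f x) @[x --> F] --> invmx A.
Proof.
move=> uA fA; have dA : \det A != 0 by rewrite -unitfE -unitmxE.
have adjE (B : 'M[R]_n) : B \in unitmx -> invmx B = (\det B)^-1 *: \adj B.
  by move=> uB; rewrite /invmx uB.
have near_unit : \forall x \near F, f x \in unitmx.
  apply: (@filterS _ F _ (fun x => \det (f x) != 0)).
    by move=> x; rewrite unitmxE unitfE.
  exact: (cvgr_neq0 _ (cvg_det fA) dA).
have fE : {near F, (fun x => (\det (f x))^-1 *: \adj (f x)) =1 (fun x => invmx (f x))}.
  by apply: filterS near_unit => x ux; rewrite adjE.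
apply: cvg_trans (near_eq_cvg fE) _; rewrite adjE //.
have cofE (B : 'M[R]_n) i j : cofactor B i j =
    (-1) ^+ (i + j) * \det (mxsub (lift i) (lift j) B).
  by rewrite mxsubrc /cofactor row'Esub col'Esub.
apply: cvg_mx => i j; under eq_fun do rewrite !mxE cofE.
rewrite !mxE cofE; apply: cvgM; first by apply: cvgV => //; exact: cvg_det.
by apply: cvgM; [exact: cvg_cst|apply: cvg_det; exact: cvg_mxsub].
Qed.

End MatrixLimits.

(** Neighbourhoods of a contain points slightly to the right of a; this and the
    next lemma let the parameter of a flow line vary a little. *)
Lemma nbhs_ex_gt {R : realType} (a b : R) (P : set R) : a < b ->
  nbhs a P -> exists s, a < s < b /\ P s.
Proof.
move=> ab /nbhs_ballP[e /= e0 eP].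
pose h := Num.min e (b - a) / 2.
have h0 : 0 < h by rewrite divr_gt0 // lt_min e0 subr_gt0.
have he : h < e by rewrite ltr_pdivrMr // gt_min ltr_pMr // ltr1n.
have hb : h < b - a.
  by rewrite ltr_pdivrMr // gt_min orbC ltr_pMr ?ltr1n ?subr_gt0.
exists (a + h); split; first by lra.
by apply: eP; rewrite /ball /= opprD addNKr normrN gtr0_norm.
Qed.

Lemma nbhs_ex_lt {R : realType} (a b : R) (P : set R) : b < a ->
  nbhs a P -> exists s, b < s < a /\ P s.
Proof.
move=> ba /nbhs_ballP[e /= e0 eP].
pose h := Num.min e (a - b) / 2.
have h0 : 0 < h by rewrite divr_gt0 // lt_min e0 subr_gt0.
have he : h < e by rewrite ltr_pdivrMr // gt_min ltr_pMr // ltr1n.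
have hb : h < a - b.
  by rewrite ltr_pdivrMr // gt_min orbC ltr_pMr ?ltr1n ?subr_gt0.
exists (a - h); split; first by lra.
by apply: eP; rewrite /ball /= opprB addrC subrK gtr0_norm.
Qed.

Lemma continuous_into_set_type (T U : topologicalType) (A : set U)
  (f : T -> set_type A) : continuous (fun x => set_val (f x)) -> continuous f.
Proof.
move=> fc; apply/continuousP => _ [B oB <-].
by move/continuousP : fc; apply.
Qed.

Lemma set_val_continuous (T : topologicalType) (A : set T) :
  continuous (set_val : set_type A -> T).
Proof. exact: (@initial_continuous (set_type A) T set_val). Qed.

(** * Sets contracted by weighted dilations *)

Section Dilations.
Variables (R : realType) (d : nat) (w : 'I_d -> nat).
Hypothesis w_gt0 : forall i, (0 < w i)%N.
Implicit Types (x y : 'rV[R]_d) (s t : R).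

Definition dil t x : 'rV[R]_d := \row_i (t ^+ w i * x 0 i).

Lemma dil_comp s t x : dil s (dil t x) = dil (s * t) x.
Proof. by apply/rowP => i; rewrite !mxE exprMn mulrA. Qed.

Lemma dil1 x : dil 1 x = x.
Proof. by apply/rowP => i; rewrite mxE expr1n mul1r. Qed.

Lemma dil0l x : dil 0 x = 0.
Proof. by apply/rowP => i; rewrite !mxE expr0n gtn_eqF // mul0r. Qed.

Lemma dil0r t : dil t 0 = 0.
Proof. by apply/rowP => i; rewrite !mxE mulr0. Qed.

Lemma cvg_dil (T : Type) (F : set_system T) {FF : Filter F}
    (f : T -> R) (g : T -> 'rV[R]_d) t x :
  f y @[y --> F] --> t -> g y @[y --> F] --> x ->
  dil (f y) (g y) @[y --> F] --> dil t x.
Proof.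
move=> ft gx; apply: cvg_mx => i j; under eq_fun do rewrite mxE.
by rewrite mxE; exact: (cvgM (cvg_exprn ft) (cvg_mx_coord gx)).
Qed.

Lemma near_dill t x (P : set 'rV[R]_d) :
  nbhs (dil t x) P -> nbhs t [set s | P (dil s x)].
Proof.
suff : dil s x @[s --> t] --> dil t x by apply.
by apply: (@cvg_dil R (nbhs t) _ id (fun=> x)); [exact: cvg_id|exact: cvg_cst].
Qed.

Lemma near_dilr t x (P : set 'rV[R]_d) :
  nbhs (dil t x) P -> nbhs x [set y | P (dil t y)].
Proof.
suff : dil t y @[y --> x] --> dil t x by apply.
by apply: (@cvg_dil _ (nbhs x) _ (fun=> t) id); [exact: cvg_cst|exact: cvg_id].
Qed.

(** Compact nonempty sets that every contracting dilation maps into their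
    interior. *)
Definition shrinkable (A : set 'rV[R]_d) : Prop :=
  [/\ closed A, A !=set0, exists M, forall x, A x -> forall i, `|x 0 i| <= M
    & forall s x, 0 < s < 1 -> A x -> nbhs (dil s x) A].

Section Gauge.
Variable A : set 'rV[R]_d.
Hypothesis shA : shrinkable A.

Let A_closed : closed A. Proof. by case: shA. Qed.
Let A_shrink s x : 0 < s < 1 -> A x -> nbhs (dil s x) A.
Proof. by case: shA => _ _ _; apply. Qed.

Lemma near_notin x : ~ A x -> nbhs x (~` A).
Proof. by move=> Ax; apply: open_nbhs_nbhs; split => //; exact: closed_openC. Qed.

(** The origin is a limit of contractions of a point of A, hence belongs to A;
    being fixed by contractions it is interior. *)
Lemma shrinkable_nbhs0 : nbhs (0 : 'rV[R]_d) A.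
Proof.
have [x Ax] : A !=set0 by case: shA.
have A0 : A 0.
  apply: contrapT => /near_notin; rewrite -(dil0l x) => /near_dill.
  move=> /(nbhs_ex_gt ltr01)[s [s01 sA]].
  by apply: sA; exact: nbhs_singleton (A_shrink s01 Ax).
rewrite -(dil0r 2^-1); apply: A_shrink => //.
by rewrite invr_gt0 ltr0n /= invf_lt1 // ltr1n.
Qed.

Definition gauge_set x : set R := [set t | 0 < t /\ A (dil t^-1 x)].
(** The Minkowski functional of A for the weighted dilations. *)
Definition gauge x : R := inf (gauge_set x).

Lemma gauge_set_nonempty x : gauge_set x !=set0.
Proof.
have : nbhs (dil 0 x) A by rewrite dil0l; exact: shrinkable_nbhs0.
move=> /near_dill /(nbhs_ex_gt ltr01)[s [/andP[s0 _] sA]].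
by exists s^-1; split; rewrite ?invr_gt0 // invrK.
Qed.

Lemma gauge_set_lbound x : lbound (gauge_set x) 0.
Proof. by move=> t [/ltW]. Qed.

Lemma gauge_ge0 x : 0 <= gauge x.
Proof. by apply: lb_le_inf; [exact: gauge_set_nonempty|exact: gauge_set_lbound]. Qed.

(** Flow lines cross the boundary of A only once: strictly inside the crossing
    time the point is interior to A. *)
Lemma gauge_ltP x t : 0 < t -> gauge x < t <-> nbhs (dil t^-1 x) A.
Proof.
move=> t0; split.
  move=> /(inf_lt (gauge_set_nonempty x))[u [u0 uA] ut].
  have -> : dil t^-1 x = dil (u / t) (dil u^-1 x).
    by rewrite dil_comp mulrAC divff ?mul1r // gt_eqF.
  by apply: A_shrink => //; rewrite divr_gt0 //= ltr_pdivrMr // mul1r.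
have ti0 : 0 < t^-1 by rewrite invr_gt0.
have tlt : t^-1 < t^-1 + 1 by rewrite ltrDl.
move=> /near_dill /(nbhs_ex_gt tlt)[s [/andP[ts _] sA]].
have s0 := lt_trans ti0 ts.
apply: (@le_lt_trans _ _ s^-1); last by rewrite -[t]invrK ltf_pV2.
apply: ge_inf; first by exists 0; exact: gauge_set_lbound.
by split; rewrite ?invr_gt0 ?invrK.
Qed.

Lemma gauge_leP x t : 0 < t -> gauge x <= t <-> A (dil t^-1 x).
Proof.
move=> t0; split; last first.
  by move=> At; apply: ge_inf; [exists 0; exact: gauge_set_lbound|split].
move=> xt; apply: contrapT => /near_notin.
have ti0 : 0 < t^-1 by rewrite invr_gt0.
move=> /near_dill /(nbhs_ex_lt ti0)[s [/andP[s0 st] sA]].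
apply: sA; rewrite -[s]invrK; apply: nbhs_singleton.
have si0 : 0 < s^-1 by rewrite invr_gt0.
apply/(gauge_ltP x si0).
by apply: le_lt_trans xt _; rewrite -[t]invrK ltf_pV2.
Qed.

Lemma gauge_le1 x : gauge x <= 1 <-> A x.
Proof. by have := gauge_leP x ltr01; rewrite invr1 dil1. Qed.

(** Points of small gauge have small coordinates; needed for the
    continuity of [radial_map] at 0, where the quotient of gauges need not
    converge. *)
Lemma gauge_bound : exists2 M, 0 <= M & forall x t i, 0 < t <= 1 ->
  gauge x <= t -> `|x 0 i| <= M * t.
Proof.
have [M AM] : exists M, forall x, A x -> forall i, `|x 0 i| <= M by case: shA.
exists `|M|; first exact: normr_ge0.
move=> x t i /andP[t0 t1] /(gauge_leP x t0) /AM/(_ i).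
rewrite mxE normrM exprVn normfV normrX (gtr0_norm t0).
rewrite mulrC ler_pdivrMr ?exprn_gt0 // => /le_trans; apply.
apply: (@le_trans _ _ (`|M| * t ^+ w i)).
  by rewrite ler_wpM2r ?ler_norm // exprn_ge0 // ltW.
by rewrite ler_wpM2l // ler_iXnr // ltW.
Qed.

Lemma gauge0 : gauge 0 = 0.
Proof.
apply/eqP; rewrite eq_le gauge_ge0 andbT; apply/ler_addgt0Pl => e e0.
rewrite addr0; apply/(gauge_leP 0 e0).
by rewrite dil0r; exact: nbhs_singleton shrinkable_nbhs0.
Qed.

Lemma gauge_eq0 x : gauge x = 0 -> x = 0.
Proof.
move=> x0; apply/rowP => i; rewrite mxE; apply/eqP.
rewrite -normr_eq0 eq_le normr_ge0 andbT.
have [M M0 HM] := gauge_bound.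
apply/ler_addgt0Pl => e e0; rewrite addr0.
pose t := Num.min 1 (e / (M + 1)).
have M1 : 0 < M + 1 by rewrite ltr_wpDl.
have t0 : 0 < t by rewrite lt_min ltr01 divr_gt0.
have t1 : t <= 1 by rewrite ge_min lexx.
have te : t <= e / (M + 1) by rewrite ge_min lexx orbT.
have Ht : `|x 0 i| <= M * t by apply: HM; [rewrite t0|rewrite x0 ltW].
apply: le_trans Ht _.
rewrite ler_pdivlMr // in te; apply: le_trans te.
by rewrite mulrC ler_pM2l // lerDl.
Qed.

Lemma gauge_dil t x : 0 < t -> gauge (dil t x) = t * gauge x.
Proof.
move=> t0; have H u : 0 < u -> (gauge (dil t x) <= u) = (t * gauge x <= u).
  move=> u0; have ut0 : 0 < u / t by rewrite divr_gt0.
  rewrite mulrC -ler_pdivlMr //; apply/idP/idP.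
    move=> /(gauge_leP _ u0); rewrite dil_comp => Au; apply/(gauge_leP _ ut0).
    by rewrite invf_div mulrC.
  move=> /(gauge_leP _ ut0); rewrite invf_div => Au; apply/(gauge_leP _ u0).
  by rewrite dil_comp mulrC.
have g0 := gauge_ge0; have tg0 : 0 <= t * gauge x by rewrite mulr_ge0 // ltW.
apply/eqP; rewrite eq_le; apply/andP; split; apply/ler_addgt0Pl => e e0.
  by rewrite H ?lerDr ?ltW // ltr_wpDr.
by rewrite -H ?lerDr ?ltW // ltr_wpDr.
Qed.

Lemma gauge_continuous : continuous gauge.
Proof.
move=> x; apply/(@cvgrPdist_lt R R 'rV[R]_d (nbhs x) _ gauge (gauge x)) => e e0.
have lo : nbhs x [set y | gauge x - e < gauge y].
  have [xe|xe] := ltP (gauge x - e) 0.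
    by apply: filterE => y; exact: lt_le_trans xe (gauge_ge0 y).
  have t0 : 0 < gauge x - e / 2 by lra.
  have : nbhs (dil (gauge x - e / 2)^-1 x) (~` A).
    apply: near_notin => /(gauge_leP x t0); lra.
  move=> /near_dilr; apply: filterS => y yA /=; rewrite ltNge; apply/negP => gy.
  by apply: yA; apply/(gauge_leP y t0); lra.
have hi : nbhs x [set y | gauge y < gauge x + e].
  have t0 : 0 < gauge x + e by rewrite ltr_wpDl ?gauge_ge0.
  have /(gauge_ltP x t0) : gauge x < gauge x + e by rewrite ltrDl.
  move=> /nbhs_interior /near_dilr; apply: filterS => y yA.
  exact/(gauge_ltP y t0).
apply: filterS2 lo hi => y /= y1 y2.
by rewrite ltr_distlC; apply/andP; split; lra.
Qed.

End Gauge.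

(** Slides x along its flow line so that its gauge for B becomes its gauge
    for A; at x = 0 the quotient is 0 / 0 but the dilation fixes 0. *)
Definition radial_map (A B : set 'rV[R]_d) x := dil (gauge A x / gauge B x) x.

Section RadialMap.
Variables A B : set 'rV[R]_d.
Hypotheses (shA : shrinkable A) (shB : shrinkable B).

Lemma gauge_gt0 C x : shrinkable C -> x != 0 -> 0 < gauge C x.
Proof.
move=> shC x0; rewrite lt0r gauge_ge0 // andbT.
by apply: contra_neq x0; exact: gauge_eq0.
Qed.

Lemma radial_map0 : radial_map A B 0 = 0.
Proof. by rewrite /radial_map dil0r. Qed.

Lemma gauge_radial_map x : gauge B (radial_map A B x) = gauge A x.
Proof.
have [->|x0] := eqVneq x 0; first by rewrite radial_map0 !gauge0.
have [a0 b0] := (gauge_gt0 shA x0, gauge_gt0 shB x0).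
by rewrite gauge_dil ?divr_gt0 // divfK // gt_eqF.
Qed.

Lemma radial_mapK : cancel (radial_map A B) (radial_map B A).
Proof.
move=> x; have [->|x0] := eqVneq x 0.
  by rewrite radial_map0 /radial_map dil0r.
have [a0 b0] := (gauge_gt0 shA x0, gauge_gt0 shB x0).
rewrite {1}/radial_map gauge_radial_map /radial_map dil_comp.
rewrite gauge_dil ?divr_gt0 // -[RHS]dil1; congr dil.
by field; rewrite !gt_eqF.
Qed.

Lemma radial_map_continuous : continuous (radial_map A B).
Proof.
move=> x; have cA := gauge_continuous shA; have cB := gauge_continuous shB.
have [->|x0] := eqVneq x 0; last first.
  apply: (@cvg_dil _ (nbhs x) _ (fun y => gauge A y / gauge B y) id); last exact: cvg_id.
  apply: cvgM; first exact: cA.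
  by apply: cvgV; [rewrite gt_eqF // gauge_gt0|exact: cB].
have [M M0 HM] := gauge_bound shB.
rewrite /continuous_at radial_map0.
apply: (@cvg_mx R _ (nbhs (0 : 'rV[R]_d))) => i j.
rewrite (ord1 i) mxE.
apply/(@cvgr0Pnorm_lt R R 'rV[R]_d (nbhs (0 : 'rV[R]_d)) _
  (fun y => radial_map A B y 0 j)) => e e0.
suff : nbhs (0 : 'rV[R]_d) [set y | `|radial_map A B y 0 j| < e] by [].
(* The bound M t is below e; M + 1 avoids a division by M = 0. *)
pose t := Num.min 1 (e / (M + 1)).
have M1 : 0 < M + 1 by rewrite ltr_wpDl.
have t0 : 0 < t by rewrite lt_min ltr01 divr_gt0.
have t1 : t <= 1 by rewrite ge_min lexx.
have te : t <= e / (M + 1) by rewrite ge_min lexx orbT.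
have : nbhs (0 : 'rV[R]_d) [set y | gauge A y < t].
  have := cA 0; rewrite /continuous_at gauge0 //.
  by move=> /(@cvgr_lt R _ (nbhs (0 : 'rV[R]_d))); apply.
apply: filterS => y /= yt.
have Ht : `|radial_map A B y 0 j| <= M * t.
  by apply: HM; [rewrite t0|rewrite gauge_radial_map ltW].
apply: le_lt_trans Ht _.
rewrite ler_pdivlMr // in te; apply: lt_le_trans te.
by rewrite mulrC ltr_pM2l // ltrDl.
Qed.

End RadialMap.

Lemma shrinkable_homeomorphic A B : shrinkable A -> shrinkable B ->
  homeomorphic (set_type A) (set_type B).
Proof.
move=> shA shB.
have fP (a : set_type A) : radial_map A B (set_val a) \in B.
  apply/mem_set/(gauge_le1 shB); rewrite gauge_radial_map //.
  by apply/(gauge_le1 shA); exact: set_valP.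
have gP (b : set_type B) : radial_map B A (set_val b) \in A.
  apply/mem_set/(gauge_le1 shA); rewrite gauge_radial_map //.
  by apply/(gauge_le1 shB); exact: set_valP.
exists (fun a => exist (fun x => x \in B) _ (fP a)),
  (fun b => exist (fun x => x \in A) _ (gP b)); split.
- apply: continuous_into_set_type => a /=.
  exact: (continuous_comp (@set_val_continuous _ _ a)
            (@radial_map_continuous A B shA shB _)).
- apply: continuous_into_set_type => a /=.
  exact: (continuous_comp (@set_val_continuous _ _ a)
            (@radial_map_continuous B A shB shA _)).
- by move=> a; apply: val_inj => /=; rewrite radial_mapK.
- by move=> a; apply: val_inj => /=; rewrite radial_mapK.
Qed.

Lemma ball_shrinkable : shrinkable (closed_euclidean_ball R d).
Proof.
pose N (x : 'rV[R]_d) := \sum_(i < d) x ord0 i ^+ 2.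
have cN : continuous N.
  move=> x; apply: (@cvg_sum_fin R _ (nbhs x)) => i.
  by apply: (@cvg_exprn R _ (nbhs x)); exact: coord_continuous.
split.
- rewrite (_ : closed_euclidean_ball R d = N @^-1` [set y | y <= 1]) //.
  by apply: closed_comp => [x _|]; [exact: cN|exact: closed_le].
- by exists 0; rewrite /closed_euclidean_ball /= big1 // => i _; rewrite mxE expr0n.
- exists 1 => x xB i.
  rewrite -[leRHS]normr1 -ler_sqr ?nnegrE // !real_normK ?num_real // expr1n.
  apply: le_trans xB; rewrite (bigD1 i) //= lerDl sumr_ge0 // => j _.
  exact: sqr_ge0.
move=> s x /andP[s0 s1] xB.
have : N (dil s x) < 1.
  apply: (@le_lt_trans _ _ (s ^+ 2)); last by rewrite expr_lt1 // ltW.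
  apply: (@le_trans _ _ (s ^+ 2 * N x)).
    rewrite /N big_distrr /=; apply: ler_sum => i _.
    have sw : s ^+ w i <= s by rewrite ler_iXnr // ltW.
    rewrite mxE exprMn ler_wpM2r ?sqr_ge0 // ler_sqr ?nnegrE // ?exprn_ge0 //.
      by rewrite ltW.
    by rewrite ltW.
  by rewrite ler_piMr ?sqr_ge0.
move=> Ns; have : nbhs (dil s x) [set y | N y < 1].
  by have /(@cvgr_lt R _ (nbhs (dil s x))) := cN (dil s x); apply.
by apply: filterS => y /ltW.
Qed.

End Dilations.

(** * The cell is homeomorphic to a ball *)

Section Cell.
Variables (R : realType) (k m : nat).
Notation n := (k + m).+1.
Notation C := (lsubmx (eigP R (k + m))).
Notation Y := (rsubmx (eigP R (k + m))).

(** Cramer's rule for the identity matrix. *)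
Lemma det_replace_col (v : 'I_k -> R) (i : 'I_k) :
  \det (\matrix_(a, b) (if b == i then v a else (a == b)%:R)) = v i.
Proof.
rewrite (expand_det_col _ i).
have cof (a : 'I_k) : cofactor (\matrix_(a, b) (if b == i then v a else (a == b)%:R)) a i = (a == i)%:R.
  have -> : (a == i)%:R = (\adj (1%:M : 'M[R]_k)) i a.
    by rewrite -[\adj _]mul1mx mul_mx_adj det1 mxE eq_sym.
  rewrite mxE /cofactor; congr (_ * \det _); apply/matrixP => c d.
  by rewrite !mxE eq_sym (negbTE (neq_lift _ _)).
under eq_bigr do rewrite cof mxE eqxx.
by rewrite (bigD1 i) //= eqxx mulr1 big1 ?addr0 // => a /negbTE->; rewrite mulr0.
Qed.

(** If V C = 1 then V times this matrix is the identity with its i-th column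
    replaced by the j-th column of V, and has determinant V i j. *)
Definition replaced_frame (i : 'I_k) (j : 'I_n) : 'M[R]_(n, k) :=
  \matrix_(a, b) (if b == i then (a == j)%:R else C a b).

Definition entry_bound (i : 'I_k) (j : 'I_n) : R :=
  \sum_(f : {ffun 'I_k -> 'I_n})
    `|\det (rowsub f C)|^-1 * `|\det (rowsub f (replaced_frame i j))|.

(** By Cauchy-Binet, k! = k! det (V C) is a sum of nonnegative terms, which
    bounds each maximal minor of V. The entry V i j, being the determinant of
    V times [replaced_frame], is a combination of those minors. *)
Lemma slice_entry_bound (V : 'M[R]_(k, n)) i j : slice V ->
  `|V i j| <= entry_bound i j.
Proof.
move=> [VC V0]; have k0 : 0 < k`!%:R :> R by rewrite ltr0n fact_gt0.
have VE : V i j = \det (V *m replaced_frame i j).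
  rewrite -(det_replace_col (fun a => V a j) i); congr (\det _).
  apply/matrixP => a b; rewrite mxE [RHS]mxE.
  case: eqVneq => [->|bi].
    rewrite (bigD1 j) //= big1 ?addr0 ?mxE ?eqxx ?mulr1 // => l lj.
    by rewrite mxE eqxx (negbTE lj) mulr0.
  have := congr1 (fun M : 'M[R]_k => M a b) VC.
  rewrite [RHS]mxE => <-; rewrite mxE; apply: eq_bigr => l _.
  by rewrite [X in _ = _ * X]mxE (negbTE bi).
have T0 := @colsub_row_ge0 _ _ _ V C.
have {}T0 (f : 'I_k -> 'I_n) : 0 <= \det (colsub f V) * \det (rowsub f C).
  by apply: T0 => g gI; rewrite mulr_ge0 ?V0 // ltW // frame_minor_gt0.
have Tk (f : {ffun 'I_k -> 'I_n}) :
    \det (colsub f V) * \det (rowsub f C) <= k`!%:R.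
  have E : k`!%:R = k`!%:R * \det (V *m C) :> R by rewrite VC det1 mulr1.
  by rewrite [leRHS]E cauchy_binet_fact (bigD1 f) //= lerDl sumr_ge0.
have Vb (f : {ffun 'I_k -> 'I_n}) :
    `|\det (colsub f V)| <= k`!%:R * `|\det (rowsub f C)|^-1.
  have [/injectiveP fI|] := boolP (injectiveb f).
    have rC : \det (rowsub f C) != 0.
      have [s /(frame_minor_gt0 R) sI] := sort_cols fI.
      move: sI; have -> : rowsub (f \o s) C = row_perm s (rowsub f C).
        by apply/matrixP => a b; rewrite !mxE.
      rewrite row_permE det_mulmx det_perm => /lt0r_neq0.
      by rewrite mulf_eq0 negb_or => /andP[].
    rewrite ler_pdivlMr ?normr_gt0 // -normrM ger0_norm //.
  move=> /injectivePn[a [b ab fab]].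
  rewrite (_ : \det (colsub f V) = 0); last first.
    by rewrite -det_tr (determinant_alternate ab) // => l; rewrite !mxE fab.
  by rewrite normr0 mulr_ge0 ?ler0n // invr_ge0.
rewrite -(ler_pM2l k0) VE -[X in X * _](gtr0_norm k0) -normrM cauchy_binet_fact.
apply: le_trans (ler_norm_sum _ _ _) _.
rewrite /entry_bound big_distrr; apply: ler_sum => f _ /=.
by rewrite normrM mulrA ler_wpM2r.
Qed.

Definition cell : set 'rV[R]_(k * m) :=
  [set x | exists2 V : 'M[R]_(k, n), slice V & x = mxvec (V *m Y)].

Lemma cvg_mxvec (T : Type) (F : set_system T) {FF : Filter F} p q
    (f : T -> 'M[R]_(p, q)) (M : 'M[R]_(p, q)) :
  f x @[x --> F] --> M -> mxvec (f x) @[x --> F] --> mxvec M.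
Proof.
move=> fM; apply: cvg_mx => i l; rewrite (ord1 i); case/mxvec_indexP: l => a b.
by under eq_fun do rewrite mxvecE; rewrite mxvecE; exact: cvg_mx_coord.
Qed.

Lemma vec_mx_continuous p q : continuous (@vec_mx R p q).
Proof.
move=> v; apply: (@cvg_mx _ _ (nbhs v)) => i j; under eq_fun do rewrite mxE.
by rewrite mxE; exact: coord_continuous.
Qed.

Lemma coord_le_norm p (x : 'rV[R]_p) i : `|x 0 i| <= `|x|.
Proof.
rewrite [leRHS]/Num.norm /= mx_normrE; apply/bigmax_geP; right.
by exists (0, i).
Qed.

Lemma slice_compact : compact [set v : 'rV[R]_(k * n) | slice (vec_mx v)].
Proof.
pose b (l : 'I_(k * n)) := mxvec (\matrix_(i, j) entry_bound i j) 0 l.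
have cbox := @rV_compact R _ (fun l => `[- b l, b l]) (fun l => @segment_compact R _ _).
apply: subclosed_compact cbox _; last first.
  move=> v /= sv l; rewrite /= in_itv /= -ler_norml /b.
  case/mxvec_indexP: l => i j; rewrite mxvecE mxE.
  by have := slice_entry_bound i j sv; rewrite mxE.
pose E (ij : 'I_k * 'I_k) : set 'rV[R]_(k * n) :=
  [set v | (vec_mx v *m C) ij.1 ij.2 = (ij.1 == ij.2)%:R].
pose N (f : 'I_k -> 'I_n) : set 'rV[R]_(k * n) :=
  [set v | 0 <= \det (colsub f (vec_mx v))].
have -> : [set v : 'rV[R]_(k * n) | slice (vec_mx v)] =
    \bigcap_(ij in setT) E ij `&` \bigcap_(f in @increasing_cols k n) N f.
  apply/seteqP; split=> [v [vC v0]|v [vC v0]].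
    split=> [ij _|f fI]; last exact: v0.
    by rewrite /E /= vC mxE.
  split; last by move=> f fI; exact: v0.
  by apply/matrixP => i j; rewrite [RHS]mxE; exact: (vC (i, j)).
apply: closedI; [apply: closed_bigI => ij _|apply: closed_bigI => f _].
  apply: (@closed_comp _ _ (fun v : 'rV[R]_(k * n) => (vec_mx v *m C) ij.1 ij.2)
    [set y | y = (ij.1 == ij.2)%:R]); last exact: closed_eq.
  move=> v _; apply: (@cvg_mx_coord R _ (nbhs v)).
  by apply: cvg_mulmx; [exact: vec_mx_continuous|exact: cvg_cst].
apply: (@closed_comp _ _ (fun v : 'rV[R]_(k * n) => \det (colsub f (vec_mx v)))
    [set y | 0 <= y]); last exact: closed_ge.
move=> v _; apply: (@cvg_det R _ (nbhs v)).
by apply: cvg_mxsub; exact: vec_mx_continuous.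
Qed.

Lemma cell_compact : compact cell.
Proof.
have -> : cell = (fun v : 'rV[R]_(k * n) => mxvec (vec_mx v *m Y)) @`
    [set v | slice (vec_mx v)].
  apply/seteqP; split=> [x [V sV ->]|_ [v sv <-]]; last by exists (vec_mx v).
  by exists (mxvec V); rewrite /= mxvecK.
apply: continuous_compact slice_compact; apply: continuous_subspaceT => v.
apply: (@cvg_mxvec _ (nbhs v)).
apply: (@cvg_mulmx _ _ (nbhs v)); first exact: vec_mx_continuous.
exact: cvg_cst.
Qed.

(** The finitely many minors of V stay positive when V Y moves a little, the
    other coordinates being kept by [slice_shift]. *)
Lemma positive_slice_nbhs (V : 'M[R]_(k, n)) : slice V -> max_minors_pos V ->
  nbhs (mxvec (V *m Y)) cell.
Proof.
move=> [VC _] Vp; pose x0 := mxvec (V *m Y).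
pose W (x : 'rV[R]_(k * m)) :=
  V + (vec_mx x - V *m Y) *m dsubmx (eigQ R (k + m)).
have W0 : W x0 = V by rewrite /W mxvecK subrr mul0mx addr0.
have cW : W x @[x --> x0] --> W x0.
  have c1 : vec_mx x - V *m Y @[x --> x0] --> vec_mx x0 - V *m Y.
    exact: cvgB (@vec_mx_continuous k m x0) (cvg_cst _).
  exact: cvgD (cvg_cst V) (cvg_mulmx c1 (cvg_cst _)).
have H (f : {ffun 'I_k -> 'I_n}) : nbhs x0
    [set x | increasing_cols f -> 0 < \det (colsub f (W x))].
  have [fI|nfI] := pselect (increasing_cols f); last first.
    by apply: filterE => x /nfI.
  have cf : \det (colsub f (W x)) @[x --> x0] --> \det (colsub f (W x0)).
    by apply: (@cvg_det _ _ (nbhs x0)); exact: cvg_mxsub.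
  have := @cvgr_gt R _ (nbhs x0) _ _ _ cf 0; rewrite W0 => /(_ _ (Vp _ fI)) H.
  have {}H : nbhs x0 [set x | 0 < \det (colsub f (W x))] by exact: H.
  by apply: filterS H => x Hx _.
have : nbhs x0 [set x | forall f : {ffun 'I_k -> 'I_n},
    increasing_cols f -> 0 < \det (colsub f (W x))].
  exact: (@filter_forall _ _ _ _ _ H).
apply: filterS => x Hx; have [WC WY] := slice_shift (vec_mx x) VC.
exists (W x); last by rewrite WY vec_mxK.
split=> // f fI; have := Hx [ffun i => f i].
have -> : colsub [ffun i => f i] (W x) = colsub f (W x).
  by apply/matrixP => i j; rewrite !mxE ffunE.
by move=> H'; apply/ltW/H' => i j; rewrite !ffunE; exact: fI.
Qed.

(** The flow acts on the (i, j) entry of the coordinate by s^(k+j) / s^i. *)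
Definition weight (l : 'I_(k * m)) : nat :=
  mxvec (\matrix_(i < k, j < m) (k + j - i)%N) 0 l.

Lemma weight_gt0 l : (0 < weight l)%N.
Proof.
rewrite /weight; case/mxvec_indexP: l => i j; rewrite mxvecE mxE subn_gt0.
by rewrite (leq_trans (ltn_ord i)) // leq_addr.
Qed.

Lemma dil_mxvec s (M : 'M[R]_(k, m)) : dil weight s (mxvec M) =
  mxvec (\matrix_(i, j) (s ^+ (k + j - i) * M i j)).
Proof.
apply/rowP => l; rewrite mxE /weight; case/mxvec_indexP: l => i j.
by rewrite !mxvecE !mxE.
Qed.

Lemma cell_shrinkable : shrinkable weight cell.
Proof.
split.
- exact: compact_closed (@norm_hausdorff _ _) cell_compact.
- by have [V sV] := slice_nonempty R k m; exists (mxvec (V *m Y)); exists V.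
- have [M [_ HM]] := compact_bounded cell_compact.
  exists (M + 1) => x cx i; apply: le_trans (coord_le_norm _ _) _.
  by apply: HM => //; rewrite ltrDl.
- move=> s x s01 [V sV ->]; have [V' [sV' pV' E]] := slice_flow s01 sV.
  by rewrite dil_mxvec -E; exact: positive_slice_nbhs.
Qed.

Lemma cell_homeomorphic_ball :
  homeomorphic (set_type cell) (set_type (closed_euclidean_ball R (k * m))).
Proof.
apply: (shrinkable_homeomorphic weight_gt0 cell_shrinkable).
exact: ball_shrinkable weight_gt0.
Qed.

End Cell.

(** * The affine chart of the amplituhedron *)

Section Chart.
Variables (R : realType) (k m : nat).
Notation n := (k + m).+1.
Notation P := (eigP R (k + m)).
Notation C := (lsubmx P).
Notation Y := (rsubmx P).
Variables (Z : 'M[R]_(k + m, n)) (d : 'rV[R]_n) (G : 'M[R]_(k + m)).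
Hypotheses (d_gt0 : forall i, 0 < d 0 i) (G_unit : G \in unitmx).
Hypothesis ZG : diag_mx d *m Z^T = P *m G.

Lemma graph_full_rank (M : 'M[R]_(k, m)) :
  row_mx 1%:M M *m G \in full_rank R k (k + m).
Proof.
apply/mem_set/eqP; rewrite -[_ == _]/(row_free _); apply/row_freeP.
exists (invmx G *m col_mx 1%:M 0).
by rewrite mulmxA mulmxK // mul_row_col mulmx0 addr0 mulmx1.
Qed.

(** The inverse of the chart: the graph of M in the basis of the rows of G. *)
Definition graph_mx (M : 'M[R]_(k, m)) : Mat R k (k + m) :=
  exist (fun A => A \in full_rank R k (k + m)) _ (graph_full_rank M).

Lemma rowspan_gl p (A B : Mat R k p) (g : 'M[R]_k) : g \in unitmx ->
  set_val A = g *m set_val B -> rowspan A = rowspan B.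
Proof. by move=> gU AB; apply/eqmodP/asboolP; exists g. Qed.

Lemma rowspan_inj_gl p (A B : Mat R k p) : rowspan A = rowspan B ->
  exists2 g : 'M[R]_k, g \in unitmx & set_val A = g *m set_val B.
Proof. by move=> /eqmodP/asboolP. Qed.

Lemma Mat_rank p (A : Mat R k p) : \rank (set_val A) = k.
Proof. exact: set_valP A. Qed.

Lemma max_minors_nonneg_diag (V : 'M[R]_(k, n)) (e : 'rV[R]_n) :
  (forall i, 0 < e 0 i) -> max_minors_nonneg V ->
  max_minors_nonneg (V *m diag_mx e).
Proof.
move=> e0 V0 f fI.
have -> : colsub f (V *m diag_mx e) =
    \matrix_(i, j) (1 * colsub f V i j * e 0 (f j)).
  by rewrite mul_mx_diag; apply/matrixP => i j; rewrite !mxE mul1r.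
rewrite det_scale_rows_cols big1 // mul1r mulr_ge0 ?V0 //.
by rewrite prodr_ge0 // => i _; rewrite ltW.
Qed.

Lemma diag_mx_unit (e : 'rV[R]_n) : (forall i, 0 < e 0 i) -> diag_mx e \in unitmx.
Proof.
move=> e0; rewrite unitmxE det_diag unitfE lt0r_neq0 //.
by rewrite prodr_gt0.
Qed.

(** In the chart the amplituhedron is the cell: scale the coordinates so that
    Z becomes the projection along the last eigenvector, then normalize V. *)
Lemma amplituhedronP (Q : Gr R k (k + m)) : amplituhedron Z Q <->
  exists2 M, cell (mxvec M) & Q = rowspan (graph_mx M).
Proof.
split.
  move=> [_ _ [V [W [Vt _ WE ->]]]].
  pose e : 'rV[R]_n := \row_i (d 0 i)^-1.
  have e0 i : 0 < e 0 i by rewrite mxE invr_gt0.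
  pose V' := set_val V *m diag_mx e.
  have rV' : \rank V' = k.
    by rewrite mxrankMfree ?Mat_rank // row_free_unit diag_mx_unit.
  have V'0 : max_minors_nonneg V' by apply: max_minors_nonneg_diag.
  have VE : set_val V = V' *m diag_mx d.
    rewrite -mulmxA (_ : diag_mx e *m diag_mx d = 1%:M) ?mulmx1 //.
    apply/matrixP => i j; rewrite mul_diag_mx !mxE.
    by case: eqVneq => [->|_]; rewrite ?mulr0 // mulVf // gt_eqF.
  have sV := slice_normalize rV' V'0.
  set a := V' *m C in sV; set V1 := invmx a *m V' in sV.
  have aU : a \in unitmx.
    apply: contraTT isT => aN; have [E _] := sV.
    have := unitmx1 R k; rewrite -E -mulmxA unitmx_mul => /andP[].
    by rewrite -/a (negbTE aN).
  exists (V1 *m Y); first by exists V1.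
  apply: (rowspan_gl aU); rewrite WE VE -mulmxA ZG /= mulmxA [RHS]mulmxA.
  have -> : row_mx 1%:M (V1 *m Y) = V1 *m P.
    by rewrite -[in RHS](hsubmxK P) mul_mx_row (proj1 sV).
  by congr (_ *m G); rewrite /V1 -[in RHS]mulmxA mulKVmx.
move=> [M [V sV /(can_inj mxvecK) ->] ->].
have V1P : V *m diag_mx d \in full_rank R k n.
  apply/mem_set; rewrite /full_rank /= mxrankMfree ?(slice_rank sV) //.
  by rewrite row_free_unit diag_mx_unit.
pose V1 : Mat R k n := exist (fun A => A \in full_rank R k n) _ V1P.
have V1t : Mat_tnn V1 by apply: max_minors_nonneg_diag => //; case: sV.
exists (rowspan V1); first by exists V1.
exists V1, (graph_mx (V *m Y)); split=> //=.
rewrite -mulmxA ZG mulmxA; congr (_ *m G).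
by rewrite -[in RHS](hsubmxK P) mul_mx_row (proj1 sV).
Qed.

Lemma nbhs_set_val (T : topologicalType) (A : set T) (x : set_type A) (B : set T) :
  nbhs (set_val x) B -> nbhs x (set_val @^-1` B).
Proof. by move=> /set_val_continuous. Qed.

Lemma open_rowspan p (O : set (Gr R k p)) :
  open (@rowspan R k p @^-1` O) -> open O.
Proof. by rewrite [X in _ -> X]/open /= /quotient_open. Qed.

Definition left_block (W : 'M[R]_(k, k + m)) := lsubmx (W *m invmx G).
Definition slope (W : 'M[R]_(k, k + m)) :=
  invmx (left_block W) *m rsubmx (W *m invmx G).
(** The coordinate a^-1 b, for W = [a | b] G. It is defined on the whole
    Grassmannian through representatives but only meaningful, and
    continuous, where a is invertible. *)
Definition chart (Q : Gr R k (k + m)) := slope (set_val (repr Q)).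

Lemma left_block_mul g W : left_block (g *m W) = g *m left_block W.
Proof. by rewrite /left_block -mulmxA mulmx_lsub. Qed.

Lemma repr_rowspan p (W : Mat R k p) :
  exists2 g : 'M[R]_k, g \in unitmx & set_val (repr (rowspan W)) = g *m set_val W.
Proof. by apply: rowspan_inj_gl; rewrite /rowspan reprK. Qed.

Lemma chart_rowspan W : left_block (set_val W) \in unitmx ->
  chart (rowspan W) = slope (set_val W).
Proof.
move=> uW; have [g gU E] := repr_rowspan W.
rewrite /chart E /slope left_block_mul -mulmxA -mulmx_rsub.
rewrite -[rsubmx _ in LHS](mulKVmx uW) [g *m (_ *m _)]mulmxA mulKmx //.
by rewrite unitmx_mul gU.
Qed.

Lemma left_block_graph M : left_block (set_val (graph_mx M)) = 1%:M.
Proof. by rewrite /left_block /= mulmxK // row_mxKl. Qed.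

Lemma chart_graph M : chart (rowspan (graph_mx M)) = M.
Proof.
rewrite chart_rowspan ?left_block_graph ?unitmx1 //.
by rewrite /slope left_block_graph invmx1 mul1mx /= mulmxK // row_mxKr.
Qed.

Lemma cvg_left_block (W : 'M[R]_(k, k + m)) :
  left_block V @[V --> W] --> left_block W.
Proof.
rewrite /left_block lsubmxEsub.
apply: (@cvg_mxsub R _ (nbhs W)).
by apply: (@cvg_mulmx R _ (nbhs W)); [exact: cvg_id|exact: cvg_cst].
Qed.

Lemma cvg_slope (W : 'M[R]_(k, k + m)) : left_block W \in unitmx ->
  slope V @[V --> W] --> slope W.
Proof.
move=> uW; apply: (@cvg_mulmx R _ (nbhs W)).
  by apply: (@cvg_invmx R _ (nbhs W)) => //; exact: cvg_left_block.
rewrite rsubmxEsub.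
apply: (@cvg_mxsub R _ (nbhs W)).
by apply: (@cvg_mulmx R _ (nbhs W)); [exact: cvg_id|exact: cvg_cst].
Qed.

(** The quotient topology is tested on the saturated open set of matrices whose
    left block is invertible, where the slope is a continuous function. *)
Lemma chart_continuous_at (W : Mat R k (k + m)) :
  left_block (set_val W) \in unitmx -> {for rowspan W, continuous chart}.
Proof.
move=> uW B /= nB.
pose O : set (Gr R k (k + m)) := [set Q |
  left_block (set_val (repr Q)) \in unitmx /\ (interior B) (chart Q)].
have OE (V : Mat R k (k + m)) : O (rowspan V) <->
    left_block (set_val V) \in unitmx /\ (interior B) (slope (set_val V)).
  have [g gU E] := repr_rowspan V.
  rewrite /O /= E left_block_mul unitmx_mul gU /=.
  by split=> -[uV]; rewrite chart_rowspan.
have oO : open O.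
  apply: open_rowspan; rewrite openE => V /= /OE[uV BV].
  have n1 : nbhs (set_val V) [set X | left_block X \in unitmx].
    have dV : \det (left_block (set_val V)) != 0 by rewrite -unitfE -unitmxE.
    have H := cvgr_neq0 _ (cvg_det (@cvg_left_block (set_val V))) dV.
    have {}H : nbhs (set_val V) [set X | \det (left_block X) != 0] by exact: H.
    by apply: filterS H => X /=; rewrite unitmxE unitfE.
  have n2 : nbhs (set_val V) [set X | (interior B) (slope X)].
    by apply: (cvg_slope uV); apply: open_nbhs_nbhs; split; [exact: open_interior|].
  have n3 : nbhs V [set X : Mat R k (k + m) |
      left_block (set_val X) \in unitmx /\ (interior B) (slope (set_val X))].
    exact: nbhs_set_val (filterI n1 n2).
  by apply: filterS n3 => X /= X12; apply/OE.
have : nbhs (rowspan W) O.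
  apply: open_nbhs_nbhs; split=> //; apply/OE; split=> //.
  by move: nB; rewrite chart_rowspan.
by apply: filterS => Q [_ /interior_subset].
Qed.

Lemma graph_continuous : continuous (fun M => rowspan (graph_mx M)).
Proof.
move=> M; apply: (@continuous_comp _ _ _ graph_mx (@rowspan R k (k + m))); last first.
  exact: pi_continuous.
apply: continuous_into_set_type => {}M.
apply: (@cvg_mulmx R _ (nbhs M)); last exact: cvg_cst.
apply: (@cvg_mx R _ (nbhs M)) => i j; under eq_fun do rewrite mxE.
rewrite mxE; case: fintype.split => l; first exact: cvg_cst.
exact: coord_continuous.
Qed.

Lemma amplituhedron_homeomorphic_cell :
  homeomorphic (set_type (amplituhedron Z)) (set_type (@cell R k m)).
Proof.
have aP (a : set_type (amplituhedron Z)) :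
    exists2 M, cell (mxvec M) & set_val a = rowspan (graph_mx M).
  by apply/amplituhedronP; exact: set_valP.
have fP (a : set_type (amplituhedron Z)) : mxvec (chart (set_val a)) \in @cell R k m.
  apply/mem_set; have [M cM ->] := aP a.
  by rewrite chart_graph.
have gP (v : set_type (@cell R k m)) :
    rowspan (graph_mx (vec_mx (set_val v))) \in amplituhedron Z.
  apply/mem_set/amplituhedronP; exists (vec_mx (set_val v)) => //.
  by rewrite vec_mxK; exact: set_valP.
exists (fun a => exist (fun x => x \in @cell R k m) _ (fP a)),
  (fun v => exist (fun x => x \in amplituhedron Z) _ (gP v)); split.
- apply: continuous_into_set_type => a /=.
  have [M _ aM] := aP a.
  apply: (@cvg_mxvec _ _ (nbhs a)).
  apply: (continuous_comp (@set_val_continuous _ _ a)).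
  rewrite aM; apply: chart_continuous_at.
  by rewrite left_block_graph unitmx1.
- apply: continuous_into_set_type => v /=.
  apply: (@continuous_comp _ _ _ (vec_mx \o set_val)
    (fun M => rowspan (graph_mx M))); last exact: graph_continuous.
  apply: continuous_comp; [exact: set_val_continuous|exact: vec_mx_continuous].
- move=> a; apply: val_inj => /=; rewrite mxvecK.
  by have [M _ aM] := aP a; rewrite aM chart_graph.
- by move=> v; apply: val_inj => /=; rewrite chart_graph vec_mxK.
Qed.

End Chart.

Lemma homeomorphic_trans (X Y T : topologicalType) :
  homeomorphic X Y -> homeomorphic Y T -> homeomorphic X T.
Proof.
move=> [f [f' [cf cf' fK f'K]]] [g [g' [cg cg' gK g'K]]].
exists (g \o f), (f' \o g'); split.
- by move=> x; apply: continuous_comp; [exact: cf|exact: cg].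
- by move=> x; apply: continuous_comp; [exact: cg'|exact: cf'].
- by move=> x /=; rewrite gK fK.
- by move=> x /=; rewrite f'K g'K.
Qed.

(** The number of columns is a variable so that k + m + 1 can be replaced by
    (k + m).+1. *)
Lemma amplituhedron_ball (R : realType) (k m n : nat) (Z : 'M[R]_(k + m, n)) :
  n = (k + m).+1 -> max_minors_pos Z ->
  homeomorphic (set_type (amplituhedron Z))
               (set_type (closed_euclidean_ball R (k * m))).
Proof.
move=> En; case: _ / (esym En) Z => Z Zp.
have [d [G [d0 uG ZG]]] := scaled_transpose_factor Zp.
apply: homeomorphic_trans (cell_homeomorphic_ball R k m).
exact: amplituhedron_homeomorphic_cell d0 uG ZG.
Qed.

Theorem theorem1p8 (R : realType) (k m : nat) (Z : 'M[R]_(k + m, k + m + 1))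
    (hk : (1 <= k)%N) (hm : ~~ odd m) (hZ : max_minors_pos Z) :
  homeomorphic (set_type (amplituhedron Z))
               (set_type (closed_euclidean_ball R (k * m))).
Proof. by apply: amplituhedron_ball; rewrite ?addn1. Qed.
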